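(* There is an absolute constant $c>0$ such that for every sufficiently small $\varepsilon>0$ there is an algorithm running in time $\mathrm{poly}(n,1/\varepsilon)$ that, given a Correlation Clustering instance $(V,E^+\uplus E^-)$ with $n=|V|$ and optimum value $\mathrm{opt}$ (not given to the algorithm), outputs a preclustered instance $(\mathcal K,E_{\mathrm{adm}})$ such that (i) there exists a clustering that is good with respect to $(\mathcal K,E_{\mathrm{adm}})$ and has cost at most $(1+\varepsilon)\,\mathrm{opt}$, and (ii) $|E_{\mathrm{adm}}|\le \frac{c}{\varepsilon^2}\,\mathrm{opt}$.
   Context: A Correlation Clustering instance consists of a finite vertex set $V$ and a partition $E^+\uplus E^-=\binom V2$ of the unordered pairs of distinct vertices into $+$edges and $-$edges. A clustering is a partition of $V$; its cost is the number of $+$edges whose endpoints lie in different parts plus the number of $-$edges whose endpoints lie in the same part; $\mathrm{opt}$ is the minimum cost. A preclustered instance is a pair $(\mathcal K,E_{\mathrm{adm}})$ where $\mathcal K$ is a partition of $V$ (its parts are called atoms) and $E_{\mathrm{adm}}\subseteq\binom V2$ is a set of pairs (admissible edges) such that for every $uv\in E_{\mathrm{adm}}$, $u$ and $v$ lie in different atoms. A pair $uv$ with both endpoints in the same atom is atomic; a pair that is neither atomic nor admissible is non-admissible. A clustering $\mathcal C$ of $V$ is good with respect to $(\mathcal K,E_{\mathrm{adm}})$ if the endpoints of every atomic pair lie in the same cluster of $\mathcal C$ and the endpoints of every non-admissible pair lie in different clusters of $\mathcal C$. *)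

(* Defs.v *)
From HB Require Import structures.
From mathcomp Require Import all_boot all_order all_algebra.
From mathcomp Require Import reals.
Set Implicit Arguments. Unset Strict Implicit. Unset Printing Implicit Defensive.
Import Order.TTheory GRing.Theory Num.Theory.
Local Open Scope ring_scope.

(* Correlation clustering on V = 'I_n.  An instance is given by the    *)
(* relation [plus] : plus i j = true iff {i,j} (i < j) is a +edge,     *)
(* otherwise it is a -edge.  Only pairs i < j are ever consulted, so   *)
(* unordered pairs are represented by ordered pairs with i < j.         *)
(* A clustering is a labelling cl : 'I_n -> 'I_n (parts = fibres);     *)
(* n labels suffice to represent every partition of V.                 *)

Definition cc_cost (n : nat) (plus : rel 'I_n) (cl : {ffun 'I_n -> 'I_n}) : nat :=
  #|[set p : 'I_n * 'I_n | (p.1 < p.2)%N &&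
      ((plus p.1 p.2 && (cl p.1 != cl p.2)) ||
       (~~ plus p.1 p.2 && (cl p.1 == cl p.2)))]|.

Definition cc_opt (n : nat) (plus : rel 'I_n) : nat :=
  cc_cost plus [arg min_(cl < [ffun i : 'I_n => i]) cc_cost plus cl]%O.

(* Preclustered instance: atoms are the fibres of [lab]; admissible    *)
(* edges are the pairs i < j with adm i j.                              *)
Definition preclustered (n : nat) (lab : 'I_n -> nat) (adm : rel 'I_n) : Prop :=
  forall i j : 'I_n, (i < j)%N -> adm i j -> lab i != lab j.

Definition num_adm (n : nat) (adm : rel 'I_n) : nat :=
  #|[set p : 'I_n * 'I_n | (p.1 < p.2)%N && adm p.1 p.2]|.

Definition good (n : nat) (lab : 'I_n -> nat) (adm : rel 'I_n)
    (cl : {ffun 'I_n -> 'I_n}) : Prop :=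
  forall i j : 'I_n, (i < j)%N ->
    (lab i = lab j -> cl i = cl j) /\
    (lab i <> lab j -> ~~ adm i j -> cl i <> cl j).

(* Machine model: deterministic single-tape Turing machines with a     *)
(* finite set of states 'I_q.+1 (start state ord0) and tape alphabet   *)
(* 'I_s.+3 (symbol 0 = blank, 1 = bit false, 2 = bit true, others are  *)
(* work symbols).  delta = None means "halt".  Move: true = right.     *)

Record TM := MkTM {
  tm_q : nat;
  tm_s : nat;
  tm_delta : 'I_tm_q.+1 -> 'I_tm_s.+3 -> option ('I_tm_q.+1 * 'I_tm_s.+3 * bool)
}.

Definition config (M : TM) : Type :=
  ('I_(tm_q M).+1 * (int -> 'I_(tm_s M).+3) * int)%type.

Definition blank (M : TM) : 'I_(tm_s M).+3 := ord0.
Definition bitsym (M : TM) (b : bool) : 'I_(tm_s M).+3 := inord (if b then 2 else 1).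

Definition tm_step (M : TM) (c : config M) : option (config M) :=
  let: (st, tape, h) := c in
  match tm_delta st (tape h) with
  | None => None
  | Some (st', a, mv) =>
      Some (st', (fun z => if z == h then a else tape z),
            if mv then h + 1 else h - 1)
  end.

Definition init_config (M : TM) (w : seq bool) : config M :=
  (ord0,
   (fun z : int => if (0 <= z) && (z < (size w)%:Z) then bitsym M (nth false w `|z|%N)
                   else blank M),
   0).

Definition tm_run (M : TM) (t : nat) (w : seq bool) : option (config M) :=
  iter t (fun oc => obind (@tm_step M) oc) (Some (init_config M w)).

Definition tape_output (M : TM) (c : config M) (out : seq bool) : Prop :=
  let: (_, tape, h) := c in
  (forall i : nat, (i < size out)%N -> tape (h + i%:Z) = bitsym M (nth false out i)) /\
  (forall b : bool, tape (h + (size out)%:Z) <> bitsym M b).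

Definition halts_with (M : TM) (w : seq bool) (t : nat) (out : seq bool) : Prop :=
  exists c : config M, tm_run M t w = Some c /\ tm_step c = None /\ tape_output c out.

Definition upairs (n : nat) : seq ('I_n * 'I_n) :=
  [seq (i, j) | i : 'I_n <- enum 'I_n, j : 'I_n <- filter (fun j : 'I_n => (i < j)%N) (enum 'I_n)].

Definition enc_inst (n : nat) (plus : rel 'I_n) : seq bool :=
  nseq n true ++ false :: [seq plus p.1 p.2 | p <- upairs n].

Definition enc_out (n : nat) (lab : 'I_n -> nat) (adm : rel 'I_n) : seq bool :=
  flatten [seq rcons (nseq (lab i) true) false | i <- enum 'I_n] ++
  [seq adm p.1 p.2 | p <- upairs n].

(* Main.v *)
Require Import Defs.
From HB Require Import structures.
From mathcomp Require Import all_boot all_order all_algebra.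
From mathcomp Require Import zify ring lra.
From mathcomp Require Import boolp.
From mathcomp Require Import reals.
Set Implicit Arguments. Unset Strict Implicit. Unset Printing Implicit Defensive.
Import Order.TTheory GRing.Theory Num.Theory.
Local Open Scope nat_scope.

(** Call [u] a center if the neighbourhoods of almost all its neighbours are very
    close to that of [u], and let the atom of [v] be given by the last center
    whose neighbourhood is close to that of [v].  Requiring the neighbours of a
    center to be twice as close as the members of its atom makes two vertices
    that agree with almost all of a nearly perfect cluster see the same centers.
    A non-atomic pair [uv] is admissible if [u] and [v] have at least [deg u / M]
    common neighbours of degree at most [M deg u], where [M] is of order
    [1 / eps].

    For the first property, take the clustering minimising the cost minus
    [1 / m] times the number of edges at its singletons, with [m] of order
    [1 / eps].  Its cost is at most [m / (m - 1)] times the optimum; making a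
    vertex a singleton does not pay, so every two vertices sharing a cluster
    satisfy the degree conditions above; and extracting the vicinity of a center
    or moving one vertex to it does not pay, so atoms are not split.

    For the second property, fix an optimal clustering.  A non-atomic pair inside
    a cluster is paid for by vertices that disagree with a constant fraction of
    it, and an admissible pair across clusters is charged to the cut edges that
    lead from it to its common neighbours.

    The algorithm only counts, with a bounded number of counters ranging up to
    the input length.  A single-tape machine stores these counters as marks on
    the input cells and performs every instruction by one sweep over the tape. *)

(** * Hamming distance between vertex sets given as predicates *)

Section Dist.
Variable T : finType.
Implicit Types a b c : pred T.

Definition dist a b := \sum_x (a x != b x : nat).

Lemma distC a b : dist a b = dist b a.
Proof. by apply: eq_bigr => x _; rewrite eq_sym. Qed.

Lemma dist_triangle b a c : dist a c <= dist a b + dist b c.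
Proof.
by rewrite -big_split; apply: leq_sum => x _; case: (a x) (b x) (c x) => [] [] [].
Qed.

Lemma sum_le_dist a b : \sum_x (a x : nat) <= \sum_x (b x : nat) + dist a b.
Proof. by rewrite -big_split; apply: leq_sum => x _; case: (a x) (b x) => [] []. Qed.

End Dist.

(** * Closed neighbourhoods, and the cost as a sum over vertices *)

Section Graph.
Variables (n : nat) (plus : rel 'I_n).

(* Neighbourhoods are closed, so that the disagreements of a vertex with its
   cluster form the symmetric difference of two sets. *)
Definition adj (i j : 'I_n) : bool :=
  [|| i == j, (i < j) && plus i j | (j < i) && plus j i].

Lemma adjxx i : adj i i. Proof. by rewrite /adj eqxx. Qed.

Lemma adjC i j : adj i j = adj j i.
Proof. by rewrite /adj eq_sym; case: (j == i) => //=; rewrite orbC. Qed.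

Definition deg i := \sum_x (adj i x : nat).
Definition dif i j := dist (adj i) (adj j).

Lemma deg_gt0 i : 0 < deg i.
Proof. by rewrite /deg (bigD1 i) //= adjxx. Qed.

Lemma deg_le i : deg i <= n.
Proof.
rewrite -[X in _ <= X]card_ord -sum1_card; apply: leq_sum => x _.
exact: leq_b1.
Qed.

Lemma dif_le i j : dif i j <= n.
Proof.
rewrite -[X in _ <= X]card_ord -sum1_card; apply: leq_sum => x _.
exact: leq_b1.
Qed.

Lemma card_upper (P : rel 'I_n) :
  #|[set p : 'I_n * 'I_n | (p.1 < p.2) && P p.1 p.2]| =
  \sum_(i : 'I_n) \sum_(j : 'I_n) ((i < j) && P i j : nat).
Proof.
rewrite -sum1dep_card pair_bigA /= big_mkcond.
by apply: eq_bigr => p _; case: (_ && _).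
Qed.

Section Cost.
Variable cl : {ffun 'I_n -> 'I_n}.

Definition same (x y : 'I_n) := cl x == cl y.
Definition err x := dist (adj x) (same x).
Definition csize x := \sum_y (same x y : nat).

(** Every disagreeing pair is seen from both endpoints; the diagonal contributes nothing because
    [adj] and [same] are reflexive. *)
Lemma sum_err : \sum_x err x = (cc_cost plus cl).*2.
Proof.
rewrite /cc_cost (card_upper (fun i j => (plus i j && (cl i != cl j))
  || (~~ plus i j && (cl i == cl j)))).
rewrite -addnn [X in _ = _ + X]exchange_big /= -big_split; apply: eq_bigr => i _ /=.
rewrite -big_split; apply: eq_bigr => j _ /=.
rewrite /adj /same [cl j == cl i]eq_sym; case: (ltngtP i j) => ij.
- by rewrite -val_eqE /= ltn_eqF //= orbF; case: (plus i j) (cl i == cl j) => [] [].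
- by rewrite -val_eqE /= gtn_eqF //=; case: (plus j i) (cl i == cl j) => [] [].
- by rewrite (val_inj ij) !eqxx.
Qed.

End Cost.
End Graph.

(** * Clusterings of minimum penalised cost *)

(** Closeness to [u] is measured in units of [deg u / slack]; 60 leaves room for the triangle
    inequalities in [near_same]. *)
Definition slack := 60.

Section Potential.
Variables (n : nat) (plus : rel 'I_n) (m : nat).
Hypothesis m_ge2 : 2 <= m.
Local Notation adj := (adj plus).
Local Notation deg := (deg plus).
Local Notation dif := (dif plus).
Local Notation err := (err plus).
Implicit Types (cl : {ffun 'I_n -> 'I_n}) (S : {set 'I_n}).

Definition center u :=
  slack * \sum_w (adj u w && (deg u < 2 * slack * dif u w) : nat) <= deg u.
Definition near u v := center u && (slack * dif u v <= deg u).

Definition single cl x := [forall y, same cl x y ==> (x == y)].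
Definition wgt cl x := m - single cl x.
(* [m] times the (doubled) cost, minus the disagreements at singletons. *)
Definition pot cl := \sum_x err cl x * wgt cl x.

Definition relabel cl S l : {ffun 'I_n -> 'I_n} :=
  [ffun x => if x \in S then l else cl x].

(** The vertices outside a nonempty [S] use fewer than [n] labels, so [n] labels suffice to turn [S]
    into a new cluster. *)
Lemma fresh_label cl S :
  S != set0 -> exists l, forall x, x \notin S -> cl x != l.
Proof.
move=> S0; have lt : #|cl @: ~: S| < #|'I_n|.
  apply: leq_ltn_trans (leq_imset_card _ _) _.
  by rewrite -(cardsC S) -[X in X < _]add0n ltn_add2r card_gt0.
case: (pickP [pred l | l \notin cl @: ~: S]) => [l /= lP|no].
  exists l => x xS; apply: contraNneq lP => <-.
  by apply: imset_f; rewrite inE.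
suff: #|'I_n| <= #|cl @: ~: S| by rewrite leqNgt lt.
by apply/subset_leq_card/subsetP => l _; move/negbFE: (no l).
Qed.

Lemma wgt_le cl x : wgt cl x <= m. Proof. exact: leq_subr. Qed.

Lemma sameC cl x y : same cl x y = same cl y x.
Proof. exact: eq_sym. Qed.

(** A vertex whose cluster shrinks can at most become a singleton, and that lowers its weight. *)
Lemma single_mono cl cl' x :
  (forall y, same cl' x y -> same cl x y) -> wgt cl' x <= wgt cl x.
Proof.
move=> h; rewrite /wgt leq_sub2l //; case: (boolP (single cl x)) => // /forallP s.
suff -> : single cl' x by [].
by apply/forallP => y; apply/implyP => /h /(implyP (s y)).
Qed.

Lemma err_split cl x v :
  err cl x = (adj x v != same cl x v) + \sum_(y | y != v) (adj x y != same cl x y).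
Proof. by rewrite /err /dist (bigD1 v). Qed.

Variable cl : {ffun 'I_n -> 'I_n}.
Hypothesis cl_min : forall cl', pot cl <= pot cl'.

(* Compare [cl] with the clustering in which [v] is made a singleton. *)
Lemma isolate_bound u v : u != v -> same cl v u ->
  2 * m * (csize cl v).+1 + deg v
    <= 4 * m * \sum_y (adj v y && same cl v y : nat) + 1.
Proof.
move=> uv suv.
have [|l lP] := @fresh_label cl [set v].
  by apply/set0Pn; exists v; rewrite inE.
set cl' := relabel cl [set v] l; have := cl_min cl'.
have sv x : x != v -> same cl' v x = false.
  move=> xv; rewrite /same !ffunE !inE eqxx (negbTE xv) eq_sym.
  by apply: negbTE; apply: lP; rewrite inE.
have sx x y : x != v -> y != v -> same cl' x y = same cl x y.
  by move=> xv yv; rewrite /same !ffunE !inE (negbTE xv) (negbTE yv).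
rewrite /pot (bigD1 v) //= [X in _ <= X](bigD1 v) //=.
set p := \sum_y _; set k := csize cl v.
have e1 : err cl v + 2 * p = deg v + k.
  rewrite /err /dist /p /deg /k /csize mul2n -addnn -!big_split; apply: eq_bigr => y _ /=.
  by case: (adj v y) (same cl v y) => [] [].
(* The company of [u] gives [v] full weight before the move. Afterwards [w2] gives [m - 1], and the
   difference leaves the term [deg v] in the bound. *)
have w1 : wgt cl v = m.
  rewrite /wgt; suff -> : single cl v = false by rewrite subn0.
  apply/negbTE/negP => /forallP/(_ u); rewrite suv /= => /eqP vu.
  by rewrite vu eqxx in uv.
have e2 : (err cl' v).+1 = deg v.
  rewrite (err_split _ _ v) /deg [RHS](bigD1 v) //= adjxx /same eqxx add0n add1n; congr _.+1.
  apply: eq_bigr => y yv; rewrite -/(same cl' v y) sv //.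
  by case: (adj v y).
have w2 : wgt cl' v = m.-1.
  rewrite /wgt; suff -> : single cl' v = true by rewrite subn1.
  apply/forallP => y; apply/implyP; case: (eqVneq v y) => // vy.
  by rewrite sv // eq_sym.
have ep : p = 1 + \sum_(y | y != v) (adj v y && same cl v y : nat).
  by rewrite /p (bigD1 v) //= adjxx /same eqxx.
have eq : k = p + \sum_(y | y != v) (~~ adj v y && same cl v y : nat).
  rewrite /k /csize (bigD1 v) //= ep -addnA -big_split /same eqxx; congr (_ + _).
  by apply: eq_bigr => y _; case: (adj v y); case: (_ == _).
set p' := \sum_(y | y != v) _ in ep; set q' := \sum_(y | y != v) _ in eq.
(* At the other vertices, removing [v] costs one per neighbour and saves one per non-neighbour in
   the old cluster; no weight increases. *)
have : \sum_(x | x != v) err cl' x * wgt cl' x + m * q'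
    <= \sum_(x | x != v) err cl x * wgt cl x + m * p'.
  rewrite /p' /q' !big_distrr -!big_split; apply: leq_sum => x xv /=.
  have wle : wgt cl' x <= wgt cl x.
    apply: single_mono => y; case: (eqVneq y v) => [->|yv]; last by rewrite sx.
    by rewrite sameC sv.
  have := wgt_le cl' x; have := wgt_le cl x.
  rewrite !(err_split _ _ v) [same cl' x v]sameC sv // adjC.
  set s := \sum_(y | _) (_ != same cl' x y).
  have -> : \sum_(y | y != v) (adj x y != same cl x y) = s.
    by apply: eq_bigr => y yv; rewrite sx.
  rewrite [same cl v x]sameC; case: (boolP (same cl x v)) => svx; last first.
    by rewrite !andbF !muln0 !addn0 => _ _; rewrite leq_mul2l wle orbT.
  suff -> : wgt cl x = m by case: (adj v x) => /=; nia.
  rewrite /wgt; suff -> : single cl x = false by rewrite subn0.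
  apply/negbTE/negP => /forallP/(_ v); rewrite svx /= => /eqP vx.
  by rewrite vx eqxx in xv.
rewrite w1 w2.
move: e1 e2 ep eq.
set f := err cl v; set f' := err cl' v; set A := \sum_(x | _) _; set A' := \sum_(x | _) _.
move=> e1 e2 ep eq hA hm.
have {}hm : f * m + m * q' <= f' * m.-1 + m * p' by lia.
nia.
Qed.


(* Compare [cl] with the clustering in which [S] is made a cluster. *)
Lemma extract_bound S : S != set0 ->
  exists2 x, x \in S & err cl x <= 4 * dist (adj x) (mem S).
Proof.
move=> S0; have [l lP] := fresh_label cl S0.
set cl' := relabel cl S l; have := cl_min cl'.
have sx x y : x \in S -> same cl' x y = (y \in S).
  move=> xS; rewrite /same !ffunE xS; case: ifP => [_|/negbT yS]; first exact: eqxx.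
  by rewrite eq_sym; apply: negbTE; apply: lP.
have sN x y : x \notin S -> same cl' x y = (y \notin S) && same cl x y.
  move=> xS; rewrite /same !ffunE (negbTE xS); case: ifP => //= _.
  by apply: negbTE; apply: lP.
rewrite /pot (bigID (mem S)) [X in _ <= X](bigID (mem S)) /=.
have h1 : \sum_(x in S) err cl' x * wgt cl' x <= m * \sum_(x in S) dist (adj x) (mem S).
  rewrite big_distrr; apply: leq_sum => x xS /=; rewrite mulnC leq_mul ?wgt_le //.
  by apply/eq_leq/eq_bigr => y _; rewrite sx.
(* Outside [S] disagreements grow only by edges into [S], and these are disagreements of members of
   [S] with [S]. *)
have h2 : \sum_(x | x \notin S) err cl' x * wgt cl' x <=
    \sum_(x | x \notin S) err cl x * wgt cl x + m * \sum_(x in S) dist (adj x) (mem S).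
  have e : \sum_(x in S) dist (adj x) (mem S) >=
      \sum_(x | x \notin S) \sum_(y in S) (adj x y : nat).
    rewrite exchange_big; apply: leq_sum => x xS; rewrite big_mkcond.
    by apply: leq_sum => y _; rewrite inE adjC; case: (y \in S) (adj x y) => [] [].
  apply: (@leq_trans (\sum_(x | x \notin S)
      (err cl x * wgt cl x + m * \sum_(y in S) (adj x y : nat)))).
    apply: leq_sum => x xS.
    have w1 : wgt cl' x <= wgt cl x by apply: single_mono => y; rewrite sN // => /andP[].
    have w2 := wgt_le cl x.
    have e1 : err cl' x <= err cl x + \sum_(y in S) (adj x y : nat).
      rewrite /err /dist [X in _ + X]big_mkcond -big_split; apply: leq_sum => y _ /=.
      by rewrite sN //; case: (y \in S) (adj x y) (same cl x y) => [] [] [].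
    apply: leq_trans (leq_mul e1 w1) _.
    by rewrite mulnDl leq_add2l mulnC leq_mul2r w2 orbT.
  by rewrite big_split /= leq_add2l -big_distrr leq_mul2l e orbT.
move=> h3; have {h1 h2 h3} h : \sum_(x in S) err cl x * wgt cl x <=
   \sum_(x in S) 2 * m * dist (adj x) (mem S).
  have aux a b c d e : a + b <= c + d -> c <= e -> d <= b + e -> a <= 2 * e by lia.
  by rewrite -big_distrr /= -mulnA; apply: aux h3 h1 h2.
(* Weights are at least [m / 2], so [h] fails if every member has error above four times its
   distance to [S]. *)
case: (pickP [pred x in S | err cl x <= 4 * dist (adj x) (mem S)]) => [x /andP[xS xP]|no].
  by exists x.
have lt x : x \in S -> 2 * m * dist (adj x) (mem S) < err cl x * wgt cl x.
  move=> xS; move/negbT: (no x); rewrite inE xS /= -ltnNge.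
  have : m <= 2 * wgt cl x by rewrite /wgt; case: (single _ _) => /=; lia.
  by nia.
case/set0Pn: S0 => y yS; move: h; rewrite leqNgt => /negP[].
rewrite (bigD1 y) //= [X in _ < X](bigD1 y) //= -addSn leq_add ?lt //.
by apply: leq_sum => x /andP[xS _]; apply/ltnW/lt.
Qed.

(** The set of very close neighbours of [u] is within one unit [deg u / slack] of [adj u], so by
    [extract_bound] some member [x] has error at most [4 * (1/2 + 1)] units. This [x] stands in for
    [u]. *)
Lemma center_cluster u : center u -> exists2 x,
  2 * slack * dif u x <= deg u & slack * err cl x <= 6 * deg u.
Proof.
move=> cu; pose S := [set w | adj u w && (2 * slack * dif u w <= deg u)].
have dS : slack * dist (adj u) (mem S) <= deg u.
  apply: leq_trans cu; rewrite leq_mul2l; apply/orP; right; apply/eq_leq/eq_bigr => w _.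
  by rewrite !inE ltnNge; case: (adj u w) (_ <= deg u) => [] [].
have [|x xS xe] := @extract_bound S.
  apply/set0Pn; exists u; rewrite inE adjxx /=.
  suff -> : dif u u = 0 by rewrite muln0.
  by rewrite /dif /dist big1 // => x _; rewrite eqxx.
move: xS; rewrite inE => /andP[ux dx]; exists x => //.
have := dist_triangle (adj u) (adj x) (mem S); rewrite [dist (adj x) (adj u)]distC.
move: dx dS xe; rewrite /dif /slack; set a := dist (adj u) (adj x).
by set b := dist (adj u) _; set c := dist (adj x) _; set d := deg u; set e := err _ _; lia.
Qed.

(* Compare [cl] with the clustering in which [v] is moved to the cluster of [x]. *)
Lemma absorb_bound x v : ~~ same cl x v ->
  csize cl x <= 5 * dist (adj v) (same cl x) + err cl x.
Proof.
move=> xv.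
set cl' := relabel cl [set v] (cl x); have := cl_min cl'.
have vx : v != x by apply: contraNneq xv => ->; rewrite /same.
have sv y : y != v -> same cl' v y = same cl x y.
  by move=> yv; rewrite /same !ffunE !inE eqxx (negbTE yv).
have sy y z : y != v -> z != v -> same cl' y z = same cl y z.
  by move=> yv zv; rewrite /same !ffunE !inE (negbTE yv) (negbTE zv).
rewrite /pot (bigD1 v) //= [X in _ <= X](bigD1 v) //=.
set q := dist _ _; set k := csize cl x.
have h1 : err cl' v <= q.
  rewrite (err_split _ _ v) adjxx /same eqxx add0n.
  rewrite /q /dist [X in _ <= X](bigD1 v) //=; apply: leq_trans (leq_addl _ _).
  by apply: eq_leq; apply: eq_bigr => y yv; rewrite -/(same cl' v y) sv.
(* A member of the cluster of [x] is a neighbour of [v], hence a disagreement of [v] in [cl], or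
   else it is counted in [q]. *)
have h2 : k <= err cl v + q.
  rewrite /k /csize /err /q /dist -big_split; apply: leq_sum => y _ /=.
  move: xv; rewrite /same; case: (eqVneq (cl x) (cl y)) => //= <-.
  by rewrite eq_sym => /negbTE ->; case: (adj v y).
(* If [x] was a singleton, its weight rises from [m - 1] to [m]; the summand [err cl x] pays for
   this. *)
have h3 : \sum_(y | y != v) err cl' y * wgt cl' y <=
    \sum_(y | y != v) err cl y * wgt cl y + m * q + err cl x.
  apply: (@leq_trans (\sum_(y | y != v) (err cl y * wgt cl y +
      m * (adj v y != same cl x y) + (x == y) * err cl x))).
    apply: leq_sum => y yv; have := wgt_le cl' y.
    rewrite [err cl' y](err_split _ _ v) [err cl y](err_split _ _ v).
    have -> : same cl' y v = same cl x y by rewrite sameC sv.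
    set s := \sum_(z | _) (_ != same cl' y z).
    have -> : \sum_(z | z != v) (adj y z != same cl y z) = s.
      by apply: eq_bigr => z zv; rewrite sy.
    rewrite adjC; case: (boolP (same cl x y)) => xy; last first.
      suff : wgt cl' y <= wgt cl y by case: (adj v y) (same cl y v) => [] [] /=; nia.
      apply: single_mono => z; case: (eqVneq z v) => [->|zv]; last by rewrite sy.
      by rewrite sameC sv // (negbTE xy).
    have -> : same cl y v = false.
      by move: xv xy; rewrite /same => xv /eqP <-; rewrite (negbTE xv).
    case: (eqVneq x y) => [exy|nxy] w'.
      rewrite exy (err_split _ _ v) {1}/wgt.
      have -> : \sum_(z | z != v) (adj y z != same cl y z) = s.
        by apply: eq_bigr => z zv; rewrite sy.
      have -> : same cl y v = false by rewrite -exy (negbTE xv).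
      have : m <= wgt cl y + 1 by rewrite /wgt; case: single => /=; lia.
      by case: (adj v y) => /=; nia.
    suff -> : wgt cl y = m by case: (adj v y) => /=; nia.
    rewrite /wgt; suff -> : single cl y = false by rewrite subn0.
    apply/negbTE/negP => /forallP/(_ x); rewrite sameC xy /= => /eqP yx.
    by rewrite yx eqxx in nxy.
  rewrite !big_split /= -addnA -addnA leq_add2l leq_add //.
    by rewrite -big_distrr /= leq_mul2l /q /dist [X in _ <= X](bigD1 v) //= leq_addl orbT.
  rewrite big_mkcond (bigD1 x) //= big1 ?addn0.
    by case: ifP; rewrite ?eqxx ?mul1n.
  by move=> y yx; rewrite [x == y]eq_sym (negbTE yx) if_same.
have := wgt_le cl' v; have : m - 1 <= wgt cl v by apply: leq_sub2l; exact: leq_b1.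
set f := err cl v in h2 *; set f' := err cl' v in h1 *; set e := err cl x in h3 *.
set w := wgt cl v; set w' := wgt cl' v => h4 h5 h6.
have aux a b c d r s : a + b <= c + d -> d <= b + r + s -> a <= c + r + s by lia.
have {}h3 := aux _ _ _ _ _ _ h6 h3; have h7 := leq_mul h1 h5.
have h8 : (k - q) * (m - 1) <= 2 * m * q + e by nia.
(* Here [m >= 2] gives [2 * m <= 4 * (m - 1)], and the factor [m - 1] cancels. *)
have h9 : (k - q) * (m - 1) <= (4 * q + e) * (m - 1) by nia.
by move: h9; rewrite leq_mul2r; case/orP => ?; lia.
Qed.

(** Take [x] from [center_cluster]. A vertex near [u] is within [deg u / 8] of the cluster of [x];
    if it were outside, [absorb_bound] would cap that cluster at [(5/8 + 1/10) * deg u], less than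
    its actual size. *)
Lemma near_same u v w : near u v -> near u w -> same cl v w.
Proof.
case/andP=> cu nv /andP[_ nw]; have [x ux ex] := center_cluster cu.
suff h y : slack * dif u y <= deg u -> same cl x y.
  by move: (h v nv) (h w nw); rewrite /same => /eqP <-.
move=> ny; apply: contraT => xy; have := absorb_bound xy.
have h1 := dist_triangle (adj u) (adj y) (same cl x).
have h2 := dist_triangle (adj x) (adj u) (same cl x).
have h3 := sum_le_dist (adj u) (same cl x).
have := deg_gt0 plus u.
move: ux ex ny h1 h2 h3; rewrite [dist (adj y) (adj u)]distC -/(dif u y) -/(dif u x) -/(err cl x).
rewrite -/(deg u) -/(csize cl x) /slack.
set d := deg u; set a := dif u x; set b := dif u y; set e := err cl x; set k := csize cl x.
set c := dist (adj y) _; set g := dist (adj u) _; lia.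
Qed.

End Potential.

(** * Atoms and admissible pairs *)

Section Precluster.
Variables (n : nat) (plus : rel 'I_n).
Local Notation adj := (adj plus).
Local Notation deg := (deg plus).
Local Notation dif := (dif plus).
Local Notation err := (err plus).
Local Notation near := (near plus).
Local Notation center := (center plus).

(** The default [v] makes a vertex that is near no center an atom of its own. *)
Definition atom v :=
  foldl (fun l u => if near u v then u else l) v (enum 'I_n).

Lemma atomP v : near (atom v) v \/ atom v = v /\ forall u, ~~ near u v.
Proof.
rewrite /atom; have : forall u, u \in enum 'I_n by move=> u; rewrite mem_enum.
move: (enum _) => s; elim/last_ind: s => [|s u IH] h; first by have := h v.
rewrite foldl_rcons; case: ifP => nu; first by left.
suff : near (foldl (fun l u => if near u v then u else l) v s) v \/
   foldl (fun l u => if near u v then u else l) v s = v /\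
   forall u, u \in s -> ~~ near u v.
  case=> [|[-> hs]]; [by left|right; split=> // u'; have := h u'].
  by rewrite mem_rcons inE => /orP[/eqP ->|/hs //]; rewrite nu.
elim/last_ind: s {IH h} => [|s u' IH]; first by right.
rewrite foldl_rcons; case: ifP => nu'; first by left.
case: IH => [|[-> hs]]; [by left|right; split=> // u''].
by rewrite mem_rcons inE => /orP[/eqP ->|/hs //]; rewrite nu'.
Qed.

Lemma atom_eq v w u :
  near u v -> (forall x, near x v = near x w) -> atom v = atom w.
Proof.
rewrite /atom; move=> nu h; have := mem_enum 'I_n u.
suff : forall s a b, u \in s ->
  foldl (fun l x => if near x v then x else l) a s =
  foldl (fun l x => if near x w then x else l) b s by move=> k; apply: k.
elim/last_ind => [|s x IH] a b //; rewrite mem_rcons inE !foldl_rcons -h.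
by case/orP => [/eqP <-|us]; [rewrite nu|rewrite (IH a b)].
Qed.

Lemma difxx u : dif u u = 0.
Proof. by rewrite /dif /dist big1 // => x _; rewrite eqxx. Qed.

Lemma near_refl u : near u u = center u.
Proof. by rewrite /near difxx muln0 andbT. Qed.

(** A center is near itself, so a vertex that is near no center is never the label of another
    vertex. *)
Lemma atom_near v w : atom v = atom w -> v != w -> exists2 u, near u v & near u w.
Proof.
move=> e vw; have c u x : near u x -> near u u by rewrite near_refl => /andP[].
case: (atomP v) (atomP w) => [nv|[ev hv]] [nw|[ew hw]].
- by exists (atom v); rewrite // e.
- by have := hw (atom v); rewrite -[X in near _ X]ew -e (c _ _ nv).
- by have := hv (atom w); rewrite -[X in near _ X]ev e (c _ _ nw).
- by rewrite -ev -ew e eqxx in vw.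
Qed.

Section Admissible.
Variable M : nat.

(** The degree cap limits the total charge on one cut edge in [count_diff]. *)
Definition witnesses i j :=
  \sum_w ([&& adj i w, adj j w & deg w <= M * deg i] : nat).

Definition admissible i j :=
  (atom i != atom j) && (deg i <= M * witnesses i j).

End Admissible.

(** * Minimum clusterings are good and nearly optimal *)

Section Good.
Variable m : nat.
Hypothesis m_ge2 : 2 <= m.
Variable cl : {ffun 'I_n -> 'I_n}.
Hypothesis cl_min : forall cl', pot plus m cl <= pot plus m cl'.

Lemma same_csize x y : same cl x y -> csize cl x = csize cl y.
Proof. by rewrite /csize /same => /eqP ->. Qed.

(** By [isolate_bound] each of the two vertices is adjacent to more than half of their cluster.
    Inclusion-exclusion yields common neighbours there, and the surplus terms [deg] of the two
    bounds make their number large. *)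
Lemma same_admissible i j : i != j -> same cl i j ->
  deg i <= 4 * m * witnesses (4 * m) i j.
Proof.
move=> ij sij; have ji : j != i by rewrite eq_sym.
have sji : same cl j i by rewrite sameC.
have bi := isolate_bound m_ge2 cl_min ji sij.
have bj := isolate_bound m_ge2 cl_min ij sji.
rewrite -(same_csize sij) in bj; set k := csize cl i in bi bj.
set pi := \sum_y _ in bi; set pj := \sum_y _ in bj.
have ple x : same cl i x -> \sum_y (adj x y && same cl x y : nat) <= k.
  move=> s; rewrite /k (same_csize s); apply: leq_sum => y _.
  by case: (adj x y).
have pile : pi <= deg i by apply: leq_sum => y _; case: (adj i y) (same cl i y) => [] [].
have di := deg_gt0 plus i; have dj := deg_gt0 plus j.
(* By [isolate_bound], [w] has degree at most [2 * m * k], while at [i] it gives [k < 2 * deg i]. *)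
have hw w : same cl i w -> deg w <= 4 * m * deg i.
  case: (eqVneq w i) => [-> _|wi siw]; first by nia.
  have swi : same cl w i by rewrite sameC.
  have iw : i != w by rewrite eq_sym.
  have := isolate_bound m_ge2 cl_min iw swi; rewrite -(same_csize siw) -/k.
  have := ple _ siw; set pw := \sum_y _; nia.
have : pi + pj <= k + witnesses (4 * m) i j.
  rewrite -!big_split; apply: leq_sum => w _ /=.
  have e : same cl j w = same cl i w by move: sij; rewrite /same => /eqP ->.
  rewrite e; case: (boolP (same cl i w)) => [/hw ->|_]; last by rewrite !andbF.
  by case: (adj i w) (adj j w) => [] [].
by set W := witnesses _ _ _; nia.
Qed.

Lemma min_good : good (fun i => atom i : nat) (admissible (4 * m)) cl.
Proof.
move=> i j ij; have nij : i != j by rewrite -val_eqE /= ltn_eqF.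
split=> [/val_inj e|ne].
  by have [u ui uj] := atom_near e nij; apply/eqP: (near_same m_ge2 cl_min ui uj).
apply: contraNnot => /eqP s; rewrite /admissible (same_admissible nij s) andbT.
by apply/negP => /eqP e; apply: ne; rewrite e.
Qed.

(** All weights lie between [m - 1] and [m], so [pot] lies between these multiples of twice the
    cost. *)
Lemma min_cost cl' : (m - 1) * cc_cost plus cl <= m * cc_cost plus cl'.
Proof.
have h : (m - 1) * \sum_x err cl x <= m * \sum_x err cl' x.
  apply: leq_trans (leq_trans (cl_min cl') _); rewrite big_distrr; apply: leq_sum => x _ /=.
    by rewrite mulnC leq_mul2l leq_sub2l ?orbT // leq_b1.
  by rewrite mulnC leq_mul2r wgt_le orbT.
by move: h; rewrite !sum_err; lia.
Qed.

End Good.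

Lemma exists_good m : 2 <= m -> exists2 cl,
  good (fun i => atom i : nat) (admissible (4 * m)) cl &
  forall cl', (m - 1) * cc_cost plus cl <= m * cc_cost plus cl'.
Proof.
move=> m2; case: (@arg_minnP _ [ffun i : 'I_n => i] xpredT (pot plus m)) => // cl _ h.
have {}h cl' : pot plus m cl <= pot plus m cl' by exact: h.
by exists cl; [apply: min_good h|apply: min_cost].
Qed.

(** * Charging admissible pairs to the cost of a clustering *)

Section Count.
Variable cl : {ffun 'I_n -> 'I_n}.

Definition cut x w := adj x w && ~~ same cl x w.

Lemma sum_cut : \sum_x \sum_w (cut x w : nat) <= 2 * cc_cost plus cl.
Proof.
rewrite mul2n -sum_err; apply: leq_sum => x _; apply: leq_sum => w _.
by rewrite /cut; case: (adj x w) (same cl x w) => [] [].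
Qed.

(* 480 = 8 * slack *)
Definition loyal v := 480 * err cl v <= csize cl v.
Definition disloyal v := \sum_y (same cl v y && ~~ loyal y : nat).

(** Two loyal members of a cluster are close because both are close to the cluster. Hence a far
    neighbour of [v] is a disagreement of [v] or disloyal, and there are few of either. *)
Lemma loyal_center v :
  loyal v -> 480 * disloyal v <= csize cl v -> center v.
Proof.
rewrite /center /loyal => lv dv.
have dk : csize cl v <= deg v + err cl v by rewrite /err distC; apply: sum_le_dist.
have : \sum_w (adj v w && (deg v < 2 * slack * dif v w) : nat) <= err cl v + disloyal v.
  rewrite -big_split; apply: leq_sum => w _ /=.
  case: (boolP (same cl v w)) => s; last by case: (adj v w); case: (_ < _).
  case: (boolP (loyal w)) => lw; last by case: (adj v w); case: (_ < _).
  suff -> : (deg v < 2 * slack * dif v w) = false by rewrite andbF.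
  apply: negbTE; rewrite -leqNgt; move: lw; rewrite /loyal.
  have -> : csize cl w = csize cl v by rewrite (same_csize s).
  have := dist_triangle (same cl v) (adj v) (adj w).
  have -> : dist (same cl v) (adj w) = err cl w.
    by rewrite distC; apply: eq_bigr => y _; move: s; rewrite /same => /eqP ->.
  rewrite -/(dif v w) -/(err cl v) /slack; move: lv dk.
  by set a := err cl v; set b := err cl w; set d := dif v w; set k := csize cl v;
    set e := deg v; lia.
rewrite /slack; set S := \sum_w _; move: lv dv dk.
by set a := err cl v; set b := disloyal v; set k := csize cl v; set e := deg v; lia.
Qed.

(** Going from [u] to [w] through [v] would exceed the tolerance. A loyal member [y] among the very
    close neighbours of [u] works: [dif u y] takes half of the tolerance, and [err y + err w] fits
    into the other half. *)
Lemma loyal_near u v w : same cl v w -> loyal v -> loyal w ->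
  480 * disloyal v <= csize cl v -> near u v -> near u w.
Proof.
move=> s lv lw dv /andP[cu nv]; rewrite /near cu /=.
have eK x y : same cl v x -> dist (adj y) (same cl x) = dist (adj y) (same cl v).
  by rewrite /same => /eqP e; apply: eq_bigr => z _; rewrite -e.
have sv x : same cl v x -> csize cl x = csize cl v by move=> e; rewrite -(same_csize e).
have h0 : dist (adj u) (same cl v) <= dif u v + err cl v by exact: dist_triangle.
have h1 : csize cl v <= deg u + dist (adj u) (same cl v) by rewrite distC; apply: sum_le_dist.
case: (pickP [pred y | [&& adj u y, same cl v y, loyal y & 2 * slack * dif u y <= deg u]])
    => [y /and4P[_ vy ly uy]|no].
  have h2 : dif u w <= dif u y + dif y w by exact: dist_triangle.
  have h3 : dif y w <= err cl y + err cl w.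
    rewrite /err (eK w) // -(eK y) // [X in _ + X]distC; exact: dist_triangle.
  move: lv lw ly uy nv; rewrite /loyal (sv w s) (sv y vy) /slack.
  move: h0 h1 h2 h3; set a := dif u w; set b := dif u y; set c := dif y w; set d := dif u v.
  by set e := deg u; set k := csize cl v; set f := err cl y; set g := err cl w;
    set i := err cl v; set j := dist _ _; lia.
(* Without such a [y], every neighbour of [u] is far from [u], outside the cluster or disloyal, and
   these are too few to make up [deg u]. *)
have : deg u <= \sum_y (adj u y && (deg u < 2 * slack * dif u y) : nat) +
    dist (adj u) (same cl v) + disloyal v.
  rewrite -!big_split; apply: leq_sum => y _ /=; move: (no y); rewrite inE ltnNge.
  by case: (adj u y) (same cl v y) (loyal y) (_ <= deg u) => [] [] [] [].
have := deg_gt0 plus u; move: h0 h1 cu nv lv dv; rewrite /center /loyal /slack.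
set a := dist _ _; set b := err cl v; set k := csize cl v; set d := deg u; set e := disloyal v.
by set f := dif u v; set S := \sum_w _; lia.
Qed.

Lemma loyal_atom v w : same cl v w -> loyal v -> loyal w ->
  480 * disloyal v <= csize cl v -> atom v = atom w.
Proof.
move=> s lv lw dv; apply: (@atom_eq _ _ v).
  by rewrite near_refl loyal_center.
move=> u; apply/idP/idP; first exact: loyal_near.
apply: loyal_near => //; first by rewrite sameC.
rewrite -(same_csize s); suff -> : disloyal w = disloyal v by [].
by apply: eq_bigr => y _; move: s; rewrite /same => /eqP ->.
Qed.

(** Let [S] be the sum of the cluster sizes of the disloyal vertices. A pair separated by the atoms
    has a disloyal first vertex, a disloyal second vertex, or a cluster of which more than 1/480 is
    disloyal; the three cases contribute at most [S], [S] and [480 * S]. *)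
Lemma count_same :
  \sum_i \sum_j (same cl i j && (atom i != atom j) : nat) <= 482 * 960 * cc_cost plus cl.
Proof.
pose S := \sum_i (~~ loyal i) * csize cl i.
have hS : S <= 960 * cc_cost plus cl.
  rewrite (_ : 960 * _ = 480 * (cc_cost plus cl).*2); last by lia.
  rewrite -sum_err big_distrr; apply: leq_sum => i _.
  rewrite /loyal; case: (leqP (480 * err cl i)) => h /=; first by rewrite mul0n.
  by rewrite mul1n ltnW.
have e1 : \sum_i \sum_j (same cl i j && ~~ loyal i : nat) = S.
  apply: eq_bigr => i _; rewrite /csize big_distrr; apply: eq_bigr => j _ /=.
  by case: (same cl i j) (loyal i) => [] [].
have e2 : \sum_i \sum_j (same cl i j && ~~ loyal j : nat) = S.
  rewrite exchange_big -e1; apply: eq_bigr => i _; apply: eq_bigr => j _.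
  by rewrite sameC.
have h3 : \sum_i \sum_j (same cl i j && (csize cl i < 480 * disloyal i) : nat) <= 480 * S.
  rewrite -e2 big_distrr; apply: leq_sum => i _ /=.
  rewrite -/(disloyal i); case: (ltnP (csize cl i) (480 * disloyal i)) => h.
    by apply: leq_trans (ltnW h); apply: leq_sum => j _; rewrite andbT.
  by rewrite big1 // => j _; rewrite andbF.
apply: (@leq_trans (S + S + 480 * S)); last by lia.
rewrite -{1}e1 -{1}e2; apply: leq_trans (leq_add (leqnn _) h3).
rewrite -!big_split; apply: leq_sum => i _; rewrite -!big_split; apply: leq_sum => j _ /=.
case: (boolP (same cl i j)) => //= s.
case: (boolP (loyal i)) => //= li; last by case: (_ != _).
case: (boolP (loyal j)) => //= lj; last by case: (_ != _).
case: (ltnP (csize cl i) _) => h; first by case: (_ != _).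
by rewrite (loyal_atom s li lj h) eqxx.
Qed.

Section Charge.
Variable M : nat.
Local Open Scope ring_scope.

(* Each pair of vertices in different clusters is charged to the cut edges
   that join one of them to a witness, with weight [M / deg i]. *)
Lemma count_diff :
  (\sum_i \sum_j (~~ same cl i j && (deg i <= M * witnesses M i j)%N : nat)
    <= 4 * M ^ 2 * cc_cost plus cl)%N.
Proof.
have dpos x : 0 < (deg x)%:R :> rat by rewrite ltr0n deg_gt0.
pose W i w : rat := (deg w <= M * deg i)%N%:R * (M%:R / (deg i)%:R).
have W0 i w : 0 <= W i w by rewrite /W mulr_ge0 ?divr_ge0.
(* The degree cap in [W] yields both bounds: [Wi] serves for summing over the [deg w] choices of
   [j], [Ww] for summing over those of [i]. *)
have Wi i w : W i w * (deg w)%:R <= (M ^ 2)%:R.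
  rewrite /W; case: leqP => h; last by rewrite !mul0r.
  rewrite mul1r mulrAC ler_pdivrMr // -!natrM ler_nat; nia.
have Ww i w : W i w <= (M ^ 2)%:R / (deg w)%:R by rewrite ler_pdivlMr.
pose c i j w : rat := (adj i w)%:R * (adj j w)%:R * ((cut i w)%:R + (cut j w)%:R) * W i w.
have h1 i j : (~~ same cl i j && (deg i <= M * witnesses M i j)%N)%:R <= \sum_w c i j w.
  have c0 w : 0 <= c i j w.
    by rewrite /c; apply: mulr_ge0 (W0 _ _); rewrite !mulr_ge0 ?addr_ge0 ?ler0n.
  case: (boolP (same cl i j)) => /= [s|s]; first by apply: sumr_ge0.
  case: leqP => [h|_]; last by apply: sumr_ge0.
  apply: (@le_trans _ _ (\sum_w ([&& adj i w, adj j w & (deg w <= M * deg i)%N] : nat)%:R *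
      (M%:R / (deg i)%:R))).
    rewrite -mulr_suml -natr_sum mulrA ler_pdivlMr // mul1r -natrM ler_nat mulnC; exact: h.
  apply: ler_sum => w _; rewrite /c /W /cut.
  have p : 0 <= M%:R / (deg i)%:R :> rat by rewrite divr_ge0.
  case: (adj i w) (adj j w) => [] [] /=; rewrite ?(mul0r, mulr0) //= !mul1r.
  case: leqP => _; rewrite ?(mul0r, mulr0) // !mul1r ler_peMl //.
  (* A witness lying in both clusters would put [i] and [j] together, so one of its two edges is
     cut. *)
  case: (boolP (same cl i w)) => iw; last by case: same => /=; lra.
  case: (boolP (same cl j w)) => jw; last by rewrite /=; lra.
  by move: iw jw s; rewrite /same => /eqP -> /eqP ->; rewrite eqxx.
have key : \sum_i \sum_j \sum_w c i j w <= (M ^ 2)%:R * (2 * 2 * cc_cost plus cl)%:R.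
  (* A cut edge [i w] is charged once for each neighbour [j] of [w], a cut edge [j w] once for each
     neighbour [i] of [w]. *)
  have -> : \sum_i \sum_j \sum_w c i j w =
     \sum_i \sum_w (cut i w)%:R * W i w * (deg w)%:R +
     \sum_j \sum_w (cut j w)%:R * \sum_i (adj i w)%:R * W i w.
    have -> : \sum_i \sum_j \sum_w c i j w =
      \sum_i \sum_j \sum_w ((cut i w)%:R * W i w * (adj j w)%:R) +
      \sum_i \sum_j \sum_w ((cut j w)%:R * ((adj i w)%:R * W i w)).
      rewrite -big_split; apply: eq_bigr => i _; rewrite -big_split; apply: eq_bigr => j _.
      rewrite -big_split; apply: eq_bigr => w _; rewrite /c /cut /=.
      by case: (adj i w) (adj j w) => [] []; rewrite /= ?(mul0r,mul1r,mulr0,mulr1,add0r,addr0) ?mulrDl.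
    congr (_ + _).
      apply: eq_bigr => i _; rewrite exchange_big; apply: eq_bigr => w _ /=.
      rewrite -mulr_sumr; congr (_ * _); rewrite /deg natr_sum.
      by apply: eq_bigr => x _; rewrite adjC.
    rewrite exchange_big; apply: eq_bigr => j _; rewrite exchange_big; apply: eq_bigr => w _ /=.
    by rewrite -mulr_sumr.
  have cutle : \sum_i \sum_w (cut i w)%:R <= (2 * cc_cost plus cl)%:R :> rat.
    under eq_bigr do rewrite -natr_sum.
    by rewrite -natr_sum ler_nat sum_cut.
  rewrite -mulnA [(2 * (2 * _))%N]mul2n -addnn natrD mulrDr; apply: lerD.
    apply: le_trans (ler_wpM2l _ cutle) => //; rewrite mulr_sumr; apply: ler_sum => i _.
    by rewrite mulr_sumr; apply: ler_sum => w _; rewrite -mulrA mulrC ler_wpM2r.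
  apply: le_trans (ler_wpM2l _ cutle) => //; rewrite mulr_sumr; apply: ler_sum => j _.
  rewrite mulr_sumr; apply: ler_sum => w _; rewrite mulrC ler_wpM2r //.
  apply: (@le_trans _ _ (\sum_i (adj i w)%:R * ((M ^ 2)%:R / (deg w)%:R))).
    by apply: ler_sum => i _; rewrite ler_wpM2l.
  rewrite -mulr_suml; have -> : \sum_i (adj i w)%:R = (deg w)%:R :> rat.
    by rewrite /deg natr_sum; apply: eq_bigr => x _; rewrite adjC.
  by rewrite mulrCA divff ?mulr1 // gt_eqF.
rewrite -(ler_nat rat); apply: le_trans (le_trans key _).
  rewrite natr_sum; apply: ler_sum => i _; rewrite natr_sum; apply: ler_sum => j _.
  exact: h1.
by rewrite -natrM ler_nat; apply: eq_leq; ring.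
Qed.

End Charge.

Lemma num_adm_le M :
  num_adm (admissible M) <= (4 * M ^ 2 + 482 * 960) * cc_cost plus cl.
Proof.
rewrite /num_adm card_upper mulnDl.
apply: leq_trans (leq_add (count_diff M) count_same).
rewrite -big_split; apply: leq_sum => i _; rewrite -big_split; apply: leq_sum => j _ /=.
rewrite /admissible.
by case: (i < j) (same cl i j) (atom i != atom j) (deg i <= _) => [] [] [] [].
Qed.

End Count.
End Precluster.

(** * Turing machines that sweep over a work zone *)

Section Reach.
Variable M : TM.

Definition run t (c : config M) := iter t (fun oc => obind (@tm_step M) oc) (Some c).

Definition reach k (c c' : config M) := exists2 t, t <= k & run t c = Some c'.

Lemma reach_trans k k' c c' c'' :
  reach k c c' -> reach k' c' c'' -> reach (k + k') c c''.
Proof.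
move=> [t tk e] [t' tk' e']; exists (t' + t); first by rewrite addnC leq_add.
by rewrite /run iterD -/(run t c) e.
Qed.

Lemma reach_refl c : reach 0 c c.
Proof. by exists 0. Qed.

Lemma reach1 c c' : tm_step c = Some c' -> reach 1 c c'.
Proof. by exists 1. Qed.

Lemma reach_le k k' c c' : k <= k' -> reach k c c' -> reach k' c c'.
Proof. by move=> h [t tk e]; exists t => //; apply: leq_trans h. Qed.

End Reach.

(** * Machines over arbitrary finite types of states and symbols *)

Section Machine.
Variables (Q A : finType) (q0 : Q) (a0 : A).

Inductive sym := Blank | Bit of bool | Work of A.

Variable delta : Q -> sym -> option (Q * sym * bool).

(** Listing [q0] first gives the start state the number 0 prescribed by the machine model. *)
Definition encQ (q : Q) : 'I_#|Q|.+1 := inord (index q (q0 :: enum Q)).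
Definition decQ (i : 'I_#|Q|.+1) : Q := nth q0 (q0 :: enum Q) i.

Lemma encQK : cancel encQ decQ.
Proof.
move=> q; have h : q \in q0 :: enum Q by rewrite inE mem_enum orbT.
rewrite /decQ /encQ inordK ?nth_index //.
by move: h; rewrite -index_mem /= -cardE.
Qed.

Lemma encQ0 : encQ q0 = ord0.
Proof. by apply: val_inj; rewrite /encQ /= eqxx inordK. Qed.

Definition encS (a : sym) : 'I_#|A|.+3 :=
  match a with
  | Blank => ord0
  | Bit b => inord (if b then 2 else 1)
  | Work a => inord (index a (enum A)).+3
  end.

Definition decS (i : 'I_#|A|.+3) : sym :=
  match val i with
  | 0 => Blank
  | 1 => Bit false
  | 2 => Bit true
  | k.+3 => Work (nth a0 (enum A) k)
  end.

Lemma encSK : cancel encS decS.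
Proof.
case=> [|b|a]; rewrite /decS //=; first by case: b; rewrite inordK.
by rewrite inordK ?nth_index ?mem_enum // !ltnS cardE index_mem mem_enum.
Qed.

Definition machine : TM := @MkTM #|Q| #|A| (fun i a =>
  omap (fun r : Q * sym * bool => (encQ r.1.1, encS r.1.2, r.2)) (delta (decQ i) (decS a))).

Definition tape (ws : seq sym) (z : int) : sym :=
  if z is Posz k then nth Blank ws k else Blank.

Definition conf q ws (h : int) : config machine := (encQ q, fun z => encS (tape ws z), h).

Lemma step_move q ws (h : int) q' mv :
  delta q (tape ws h) = Some (q', tape ws h, mv) ->
  tm_step (conf q ws h) = Some (conf q' ws (if mv then h + 1 else h - 1)%R).
Proof.
move=> e; rewrite /tm_step /= encQK encSK e /=; congr (Some (_, _, _)).
by apply: funext => z; case: eqP => // ->.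
Qed.

Lemma step_write q ws k q' a mv :
  delta q (nth Blank ws k) = Some (q', a, mv) ->
  tm_step (conf q ws k%:Z) =
    Some (conf q' (set_nth Blank ws k a) (if mv then k%:Z + 1 else k%:Z - 1)%R).
Proof.
move=> e; rewrite /tm_step /= encQK encSK e /=; congr (Some (_, _, _)).
apply: funext => -[j|j] //=; rewrite nth_set_nth /=.
by rewrite eqz_nat; case: eqP.
Qed.

Lemma step_stop q ws (h : int) : delta q (tape ws h) = None -> tm_step (conf q ws h) = None.
Proof. by move=> e; rewrite /tm_step /= encQK encSK e. Qed.

End Machine.
Arguments Blank {A}.
Arguments Bit {A} _.

(* Every instruction of the machine below is a left-to-right pass of a finite
   transducer over the work zone, which starts at cell 0; the output produced so
   far is kept as raw bits immediately to the right of the work zone. *)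
Section Sweep.
Variables (A P S : finType) (s0 : S) (mealy : P -> S -> A -> S * A).
Variables (act : P -> S -> option P * option bool) (mark : bool -> option bool -> A).
Variable entry : option P.

(** In order, the summands are: [Ini] turns the input into the work zone, [Ret] goes back to the
    blank on the left, [Fwd] runs the transducer, [Emit] carries a bit to the end of the output,
    [Fin] moves to the output and halts. *)
Definition state : finType := (bool + (option P + (P * S + (option P * bool + unit))))%type.

Definition Ini f : state := inl f.
Definition Ret p : state := inr (inl p).
Definition Fwd p s : state := inr (inr (inl (p, s))).
Definition Emit p b : state := inr (inr (inr (inl (p, b)))).
Definition Fin : state := inr (inr (inr (inr tt))).

Definition delta (q : state) (a : sym A) : option (state * sym A * bool) :=
  match q with
  | inl f =>
    match a with
    | Bit b => Some (Ini false, Work (mark f (Some b)), true)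
    | Blank => Some (Ret entry, Work (mark f None), false)
    | Work _ => None
    end
  | inr (inl p) =>
    if a is Blank then Some (if p is Some p then Fwd p s0 else Fin, Blank, true)
    else Some (Ret p, a, false)
  | inr (inr (inl (p, s))) =>
    if a is Work a then let: (s', a') := mealy p s a in Some (Fwd p s', Work a', true)
    else let: (p', ob) := act p s in
      if ob is Some b then
        if a is Bit _ then Some (Emit p' b, a, true) else Some (Ret p', Bit b, false)
      else Some (Ret p', a, false)
  | inr (inr (inr (inl (p, b)))) =>
    match a with
    | Bit _ => Some (Emit p b, a, true)
    | Blank => Some (Ret p, Bit b, false)
    | Work _ => None
    end
  | inr (inr (inr (inr _))) => if a is Work _ then Some (Fin, a, true) else None
  end.

Definition sweeper := machine (Ini true) (mark true None) delta.
Local Notation conf := (@conf state A (Ini true) (mark true None) delta).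

Fixpoint transduce p s (x : seq A) : S * seq A :=
  if x is a :: x' then
    let: (s', a') := mealy p s a in
    let: (s'', y) := transduce p s' x' in (s'', a' :: y)
  else (s, [::]).

Lemma transduce_cons p s a x : transduce p s (a :: x) =
  ((transduce p (mealy p s a).1 x).1,
   (mealy p s a).2 :: (transduce p (mealy p s a).1 x).2).
Proof. by rewrite /=; case: (mealy p s a) => s' a'; case: transduce. Qed.

Definition zone (x : seq A) (o : seq bool) : seq (sym A) := map (@Work A) x ++ map Bit o.

Lemma size_zone x o : size (zone x o) = size x + size o.
Proof. by rewrite size_cat !size_map. Qed.

(* Between two passes the head is on the blank cell to the left of the work zone. *)
Definition at_rest p x o := conf (Ret p) (zone x o) (-1)%R.

Definition nonblank (a : sym A) := if a is Blank then false else true.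

Lemma return_reach p ws k : all nonblank ws -> k <= size ws ->
  reach k (conf (Ret p) ws (k%:Z - 1)%R) (conf (Ret p) ws (-1)%R).
Proof.
move=> nb; elim: k => [|k IH] ks; first by rewrite sub0r; apply: reach_refl.
rewrite -add1n; apply: reach_trans (IH (ltnW ks)); apply: reach1.
have -> : (k.+1%:Z - 1 = k%:Z)%R by lia.
rewrite (@step_move _ _ _ _ _ _ _ _ (Ret p) false) //=.
by move/all_nthP: nb => /(_ Blank k ks); case: (nth _ _ _).
Qed.

Lemma set_nth_cat (T : Type) (d : T) l a r b :
  set_nth d (l ++ a :: r) (size l) b = l ++ b :: r.
Proof. by elim: l => //= x l ->. Qed.

Lemma set_nth_size (T : Type) (d : T) l b : set_nth d l (size l) b = rcons l b.
Proof. by elim: l => //= x l ->. Qed.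

Lemma forward_reach p x : forall s l r,
  reach (size x) (conf (Fwd p s) (l ++ map (@Work A) x ++ r) (size l)%:Z)
    (conf (Fwd p (transduce p s x).1) (l ++ map (@Work A) (transduce p s x).2 ++ r)
       (size l + size x)%:Z).
Proof.
elim: x => [|a x IH] s l r /=; first by rewrite addn0; apply: reach_refl.
case e : (mealy p s a) => [s' a']; have := IH s' (rcons l (Work a')) r.
case: (transduce p s' x) => s'' y /=; rewrite size_rcons !cat_rcons addSnnS => h.
rewrite -add1n; apply: reach_trans h; apply: reach1.
rewrite (@step_write _ _ _ _ _ _ _ _ (Fwd p s') (Work a') true) /=; last first.
  by rewrite nth_cat ltnn subnn /= e.
by rewrite set_nth_cat addrC.
Qed.

Lemma emit_reach p b x o j : j <= size o ->
  reach j (conf (Emit p b) (zone x o) (size x + size o - j)%:Z)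
    (conf (Emit p b) (zone x o) (size x + size o)%:Z).
Proof.
elim: j => [|j IH] jo; first by rewrite subn0; apply: reach_refl.
rewrite -add1n; apply: reach_trans (IH (ltnW jo)); apply: reach1.
rewrite (@step_move _ _ _ _ _ _ _ _ (Emit p b) true) /=.
  by congr Some; congr conf; lia.
rewrite nth_cat size_map ltnNge (_ : size x <= _) /=; last by lia.
by rewrite (nth_map false) //; lia.
Qed.

Lemma size_transduce p s x : size (transduce p s x).2 = size x.
Proof.
elim: x s => //= a x IH s; case: (mealy p s a) => s' a'.
by have := IH s'; case: (transduce p s' x) => s'' y /= ->.
Qed.

Lemma nonblank_zone x o : all nonblank (zone x o).
Proof. by rewrite all_cat !all_map; apply/andP; split; apply/allP. Qed.

(** A pass crosses the work zone and the output at most once in each direction. *)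
Lemma pass_reach p x o : let: (s, y) := transduce p s0 x in let: (p', ob) := act p s in
  reach (2 * (size x + size o) + 4) (at_rest (Some p) x o)
    (at_rest p' y (if ob is Some b then rcons o b else o)).
Proof.
case e : (transduce p s0 x) => [s y]; case ea : (act p s) => [p' ob].
have sy : size y = size x by rewrite -(size_transduce p s0 x) e.
have h1 : reach 1 (at_rest (Some p) x o) (conf (Fwd p s0) (zone x o) 0%R).
  by apply: reach1; rewrite (@step_move _ _ _ _ _ _ _ _ (Fwd p s0) true).
have := forward_reach p x s0 [::] (map Bit o); rewrite e /= add0n -/(zone y o) => h2.
have {h1 h2} h := reach_trans h1 h2.
have back q x' o' k : k <= size (zone x' o') ->
    reach k (conf (Ret q) (zone x' o') (k%:Z - 1)%R) (at_rest q x' o').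
  by move=> h'; apply: return_reach => //; apply: nonblank_zone.
case: ob ea => [b|] ea; last first.
  have h3 : reach 1 (conf (Fwd p s) (zone y o) (size x)%:Z)
      (conf (Ret p') (zone y o) ((size x)%:Z - 1)%R).
    apply: reach1; rewrite (@step_move _ _ _ _ _ _ _ _ (Ret p') false) //=.
    by rewrite nth_cat size_map sy ltnn subnn; case: (o) => [|? ?] /=; rewrite ea.
  apply: reach_le (reach_trans (reach_trans h h3) (back _ _ _ _ _)); first by lia.
  by rewrite size_zone; lia.
have wr q : delta q Blank = Some (Ret p', Bit b, false) ->
    reach (1 + (size x + size o)) (conf q (zone y o) (size x + size o)%:Z)
      (at_rest p' y (rcons o b)).
  move=> eq; apply: reach_trans (back _ _ _ _ _); last by rewrite size_zone size_rcons; lia.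
  apply: reach1; rewrite (@step_write _ _ _ _ _ _ _ _ (Ret p') (Bit b) false) /=; last first.
    by rewrite nth_default // size_zone sy.
  by rewrite -sy -size_zone set_nth_size /zone map_rcons rcons_cat.
(* When the output is empty, the transducer meets a blank right after the zone and writes the bit
   without passing through [Emit]. *)
case: o h back wr => [|b0 o] h back wr.
  apply: reach_le (reach_trans h _); last first.
    by have := wr (Fwd p s); rewrite /= addn0; apply; rewrite ea.
  by rewrite /=; lia.
have h3 : reach 1 (conf (Fwd p s) (zone y (b0 :: o)) (size x)%:Z)
    (conf (Emit p' b) (zone y (b0 :: o)) (size y + (size o).+1 - size o)%:Z).
  apply: reach1; rewrite (@step_move _ _ _ _ _ _ _ _ (Emit p' b) true) /=.
    by congr Some; congr conf; lia.
  by rewrite nth_cat size_map sy ltnn subnn /= ea.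
have h4 := @emit_reach p' b y (b0 :: o) (size o) (leqnSn _).
have := wr (Emit p' b) erefl; rewrite -{2}sy => h5.
by apply: reach_le (reach_trans (reach_trans (reach_trans h h3) h4) h5) => /=; lia.
Qed.

Fixpoint marks f (w : seq bool) : seq A :=
  if w is b :: w' then mark f (Some b) :: marks false w' else [:: mark f None].

Lemma size_marks f w : size (marks f w) = (size w).+1.
Proof. by elim: w f => //= b w IH f; rewrite IH. Qed.

Lemma mark_reach f w l :
  reach (size w).+1 (conf (Ini f) (map (@Work A) l ++ map Bit w) (size l)%:Z)
    (conf (Ret entry) (map (@Work A) (l ++ marks f w)) ((size l + size w)%:Z - 1)%R).
Proof.
elim: w f l => [|b w IH] f l /=.
  rewrite cats0 addn0; apply: reach1.
  rewrite (@step_write _ _ _ _ _ _ _ _ (Ret entry) (Work (mark f None)) false) /=.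
    by rewrite -(size_map (@Work A)) set_nth_size map_cat cats1.
  by rewrite nth_default // size_map.
rewrite -add1n; have := IH false (rcons l (mark f (Some b))).
rewrite size_rcons map_rcons !cat_rcons addSnnS => h; apply: reach_trans h; apply: reach1.
rewrite (@step_write _ _ _ _ _ _ _ _ (Ini false) (Work (mark f (Some b))) true) /=.
  by rewrite -(size_map (@Work A) l) set_nth_cat addrC.
by rewrite nth_cat size_map ltnn subnn.
Qed.

Lemma init_confE w : init_config sweeper w = conf (Ini true) (map Bit w) 0%R.
Proof.
rewrite /init_config /conf encQ0; congr (_, _, _); apply: funext => -[k|k] //=.
rewrite ltz_nat; case: ltnP => kw; first by rewrite (nth_map false).
by rewrite nth_default ?size_map.
Qed.

Lemma init_reach w :
  reach (2 * (size w).+1) (init_config sweeper w) (at_rest entry (marks true w) [::]).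
Proof.
rewrite init_confE; have := mark_reach true w [::]; rewrite /= add0n => h.
apply: reach_le (reach_trans h _); last first.
  rewrite /at_rest /zone cats0; apply: return_reach; first by rewrite all_map; apply/allP.
  by rewrite size_map size_marks.
by lia.
Qed.

(** The head stops just after the work zone, where the output starts; the blank behind the raw bits
    delimits it. *)
Lemma halt_reach x o : exists c, [/\ reach (size x).+1 (at_rest None x o) c,
  tm_step c = None & tape_output c o].
Proof.
exists (conf Fin (zone x o) (size x)%:Z).
have nz i : nth Blank (zone x o) (size x + i) = nth Blank (map Bit o) i.
  by rewrite nth_cat size_map ltnNge leq_addr addKn.
split.
- rewrite -add1n; apply: (@reach_trans _ _ _ _ (conf Fin (zone x o) 0%R)).
    by apply: reach1; rewrite (@step_move _ _ _ _ _ _ _ _ Fin true).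
  suff h k : k <= size x -> reach k (conf Fin (zone x o) 0%R) (conf Fin (zone x o) k%:Z).
    exact: h.
  elim: k => [|k IH] kx; first exact: reach_refl.
  rewrite -addn1; apply: reach_trans (IH (ltnW kx)) _; apply: reach1.
  case: x kx {IH nz} => // a0 x kx.
  rewrite (@step_move _ _ _ _ _ _ _ _ Fin true) //=.
  by rewrite nth_cat size_map kx (nth_map a0).
- apply: step_stop; rewrite /= -[size x]addn0 nz.
  by case: o {nz}.
- split=> [i io|b]; rewrite /= nz.
    by rewrite (nth_map false).
  rewrite nth_default ?size_map // => h.
  by have := can_inj (encSK (mark true None)) (h : encS Blank = encS (Bit b)).
Qed.

End Sweep.

(** * A language of counters and bounded loops *)

Section Language.
Variables (X : finType) (END : X).

(* A test sees which counters are ordered, which point at a 1 of the input,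
   and which are zero. *)
Definition test := (X -> X -> bool) -> (X -> bool) -> (X -> bool) -> bool.

Inductive instr :=
  | IZero of X
  | ICopy of X & X
  | IIncr of X
  | IOut of bool
  | ITest of test.

Definition cell : finType := (option bool * {set X})%type.
(* First cell?, marks on the previous cell, counters seen so far, and the three
   relations available to tests, restricted to those counters. *)
Definition summary : finType :=
  (bool * {set X} * {set X} * {set X * X} * {set X} * {set X})%type.

Definition summary0 : summary := (true, set0, set0, set0, set0, set0).

(** An increment moves the mark of [r] one cell to the right, hence the memory of the previous cell;
    on the end cell the mark stays. *)
Definition sees (i : instr) (first : bool) (prev : {set X}) (a : cell) (x : X) : bool :=
  match i with
  | IZero r => if x == r then first else x \in a.2
  | ICopy r s => (if x == r then s else x) \in a.2
  | IIncr r =>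
    if x == r then (x \in prev) || (a.1 == None) && (x \in a.2) else x \in a.2
  | _ => x \in a.2
  end.

Definition transition (i : instr) (s : summary) (a : cell) : summary * cell :=
  let: (first, prev, seen, le, bit, zero) := s in
  ((false, a.2, seen :|: a.2,
    le :|: [set p | (p.1 \in seen :|: a.2) && (p.2 \in a.2)],
    (if a.1 == Some true then bit :|: a.2 else bit),
    (if first then zero :|: a.2 else zero)),
   (a.1, [set x | sees i first prev a x])).

Definition verdict (i : instr) (s : summary) : bool :=
  let: (_, _, _, le, bit, zero) := s in
  if i is ITest t then
    t (fun x y => (x, y) \in le) (fun x => x \in bit) (fun x => x \in zero)
  else false.

(** All counters start at 0 except [END], which sits on the end cell and so holds the input
    length. *)
Definition start_cell (first : bool) (b : option bool) : cell :=
  (b, if first then ~: [set END] else if b == None then [set END] else set0).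

Section Exec.
Variable w : seq bool.
Local Notation L := (size w).

Definition env := X -> nat.
Implicit Types (e : env).

Definition upd e r v : env := fun x => if x == r then v else e x.
Definition bounded e := forall x, e x <= L.

Definition eval (t : test) e :=
  t (fun x y => e x <= e y) (fun x => nth false w (e x)) (fun x => e x == 0).

(* Counters saturate at the length of the input. *)
Definition exec_env (i : instr) e : env :=
  match i with
  | IZero r => upd e r 0
  | ICopy r s => upd e r (e s)
  | IIncr r => upd e r (minn L (e r).+1)
  | _ => e
  end.

Definition exec_out (i : instr) (o : seq bool) := if i is IOut b then rcons o b else o.
Definition exec_test (i : instr) e := if i is ITest t then eval t e else false.

Lemma exec_bounded i e : bounded e -> bounded (exec_env i e).
Proof.
by move=> h; case: i => [r|r s|r|b|t] //= x; rewrite /upd; case: ifP => // _;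
  rewrite geq_minl.
Qed.

(* Cell [k] carries the [k]-th input bit and the counters of value [k]; one more
   cell, without a bit, marks the end of the input. *)
Definition env_cell e k : cell :=
  (if k < L then Some (nth false w k) else None, [set x | e x == k]).
Definition cells e : seq cell := [seq env_cell e k | k <- iota 0 L.+1].

Definition summary_at e k : summary :=
  (k == 0, [set x | (e x).+1 == k], [set x | e x < k],
   [set p | e p.1 <= e p.2 < k], [set x | (e x < k) && nth false w (e x)],
   [set x | (e x == 0) && (0 < k)]).

(** The invariant of a pass: on reaching cell [k], the summary knows the counters of value below
    [k]. *)
Lemma transition_at i e k : bounded e -> k <= L ->
  transition i (summary_at e k) (env_cell e k) =
    (summary_at e k.+1, env_cell (exec_env i e) k).
Proof.
move=> eb kL; rewrite /transition /summary_at /env_cell /=.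
congr (_, (_, _)).
  congr (_, _, _, _, _, _).
  - by apply/setP => x; rewrite !inE; lia.
  - by apply/setP => -[x y]; rewrite !inE /=; lia.
  (* On the end cell both sides are false, the right one by the default value of [nth]. *)
  - have -> : ((if k < L then Some (nth false w k) else None) == Some true) = nth false w k.
      by case: ltnP => h; [case: nth|rewrite nth_default].
    case: ifP => nk; apply/setP => x; rewrite !inE;
      rewrite (_ : (e x < k.+1) = (e x == k) || (e x < k)) ?[RHS]andb_orl; try lia.
      by case: eqP => [->|_]; rewrite ?nk ?orbT ?orbF.
    by case: eqP => [->|_]; rewrite ?nk ?andbF.
  - case: eqP => [->|k0]; apply/setP => x; rewrite !inE; first by rewrite andbF andbT.
    by move/eqP: k0; rewrite -lt0n => ->.
apply/setP => x; rewrite !inE; case: i => [r|r s|r|b|t] //=; rewrite /upd ?inE //.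
- by case: (x =P r); rewrite ?inE // eq_sym.
- by case: (x =P r).
case: (x =P r) => [->|_]; rewrite ?inE //.
by case: ltnP => h /=; have := eb r; lia.
Qed.

Lemma transduce_cells (P : finType) (ins : P -> instr) p e : bounded e ->
  transduce (fun p => transition (ins p)) p summary0 (cells e) =
    (summary_at e L.+1, cells (exec_env (ins p) e)).
Proof.
move=> eb; have -> : summary0 = summary_at e 0.
  rewrite /summary_at /summary0 /=; congr (_, _, _, _, _, _);
  by apply/setP => x; rewrite !inE ?andbF.
suff h k j : j + k = L.+1 ->
    transduce (fun p => transition (ins p)) p (summary_at e j)
      [seq env_cell e i | i <- iota j k] =
    (summary_at e L.+1, [seq env_cell (exec_env (ins p) e) i | i <- iota j k]) by exact: h.
elim: k j => [|k IH] j; first by rewrite addn0 => ->.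
move=> e1; rewrite -[iota j k.+1]/(j :: iota j.+1 k) !map_cons transduce_cons.
rewrite transition_at //; last by lia.
by rewrite [(_, _).1]/= [(_, _).2]/= IH //; lia.
Qed.

Lemma verdict_at i e : bounded e -> verdict i (summary_at e L.+1) = exec_test i e.
Proof.
move=> eb; case: i => //= t; rewrite /eval; congr (t _ _ _).
- by apply: funext => x; apply: funext => y; rewrite inE /= ltnS eb andbT.
- by apply: funext => x; rewrite inE ltnS eb.
- by apply: funext => x; rewrite inE andbT.
Qed.

End Exec.

Definition start_env (w : seq bool) : env := fun x => if x == END then size w else 0.

Lemma start_bounded w : bounded w (start_env w).
Proof. by move=> x; rewrite /start_env; case: ifP. Qed.

Lemma marks_start w : 0 < size w ->
  marks start_cell true w = cells w (start_env w).
Proof.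
move=> w0; rewrite /cells.
suff h (f : bool) k (v : seq bool) : (f -> k = 0) -> (~~ f -> 0 < k) -> k + size v = size w ->
    (f -> 0 < size v) -> v = drop k w ->
    marks start_cell f v = [seq env_cell w (start_env w) j | j <- iota k (size v).+1].
  by apply: h => //; rewrite drop0.
elim: v f k => [|b v IH] f k f0 f1 kw fv dv /=.
  case: f f0 f1 fv => f0 f1 fv; first by have := fv isT.
  rewrite /start_cell /env_cell /= addn0 in kw *; rewrite kw ltnn; congr [:: (_, _)].
  by apply/setP => x; rewrite !inE /start_env; case: eqP => // _; rewrite ?eqxx //; lia.
rewrite (IH false k.+1) //=; last 2 first.
- by move: kw => /=; lia.
- by rewrite -addn1 addnC -drop_drop -dv /= drop0.
congr (_ :: _); rewrite /start_cell /env_cell.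
have kL : k < size w by move: kw => /=; lia.
rewrite kL; congr (_, _); first by rewrite -[k]addn0 -nth_drop -dv.
apply/setP => x; case: f f0 f1 {fv} => f0 f1 /=; rewrite !inE /start_env.
  by rewrite f0 //; case: eqP => // _; rewrite eqn0Ngt w0.
by have := f1 isT; case: ifP => _ h; symmetry; apply/eqP; lia.
Qed.

(** * Structured commands, their labelled code and their semantics *)

Inductive cmd :=
  | Zero of X
  | Copy of X & X
  | Incr of X
  | Out of bool
  | Seq of cmd & cmd
  | If of test & cmd & cmd
  | For of X & X & cmd.

(* In a loop, [inl None], [inl (Some false)] and [inl (Some true)] label the
   initialisation, the test and the increment of the loop counter. *)
Fixpoint label (c : cmd) : finType :=
  match c with
  | Seq c1 c2 => (label c1 + label c2)%type
  | If _ c1 c2 => option (label c1 + label c2)%type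
  | For _ _ c => (option bool + label c)%type
  | _ => unit
  end.

Fixpoint first_label (c : cmd) : label c :=
  match c return label c with
  | Seq c1 c2 => inl (first_label c1)
  | If _ c1 c2 => None
  | For _ _ c => inl None
  | _ => tt
  end.

Fixpoint code (c : cmd) : label c -> instr :=
  match c return label c -> instr with
  | Zero r => fun=> IZero r
  | Copy r s => fun=> ICopy r s
  | Incr r => fun=> IIncr r
  | Out b => fun=> IOut b
  | Seq c1 c2 => fun p => match p with inl p => code p | inr p => code p end
  | If t c1 c2 => fun p =>
    match p with
    | None => ITest t
    | Some (inl p) => code p
    | Some (inr p) => code p
    end
  | For r s c => fun p =>
    match p with
    | inl None => IZero r
    | inl (Some false) => ITest (fun le _ _ => ~~ le s r)
    | inl (Some true) => IIncr r
    | inr p => code p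
    end
  end.

Fixpoint next (c : cmd) : label c -> bool -> option (label c) :=
  match c return label c -> bool -> option (label c) with
  | Seq c1 c2 => fun p b =>
    match p with
    | inl p => Some (if next p b is Some p' then inl p' else inr (first_label c2))
    | inr p => omap inr (next p b)
    end
  | If t c1 c2 => fun p b =>
    match p with
    | None => Some (Some (if b then inl (first_label c1) else inr (first_label c2)))
    | Some (inl p) => omap (fun p' => Some (inl p')) (next p b)
    | Some (inr p) => omap (fun p' => Some (inr p')) (next p b)
    end
  | For r s c => fun p b =>
    match p with
    | inl None => Some (inl (Some false))
    | inl (Some false) => if b then Some (inr (first_label c)) else None
    | inl (Some true) => Some (inl (Some false))
    | inr p => Some (if next p b is Some p' then inr p' else inl (Some true))
    end
  | _ => fun _ _ => None
  end.

Section Semantics.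
Variable w : seq bool.
Local Notation L := (size w).

Definition store := (env * seq bool)%type.

Definition exec (i : instr) (s : store) : store := (exec_env w i s.1, exec_out i s.2).

(** The index counts executed instructions, each of which is one pass of the machine. *)
Inductive runs (c : cmd) : nat -> label c -> store -> store -> Prop :=
  | runs_exit p s : next p (exec_test w (code p) s.1) = None ->
      runs 1 p s (exec (code p) s)
  | runs_next p p' k s s' : next p (exec_test w (code p) s.1) = Some p' ->
      runs k p' (exec (code p) s) s' -> runs k.+1 p s s'.

Lemma runs_seqr c1 c2 k p s s' : @runs c2 k p s s' ->
  @runs (Seq c1 c2) k (inr p) s s'.
Proof.
elim=> {k p s s'} [p s e|p p' k s s' e _ IH].
  by apply: (@runs_exit (Seq c1 c2) (inr p)); rewrite /= e.
by apply: (@runs_next (Seq c1 c2) (inr p) _ _ _ _ _ IH); rewrite /= e.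
Qed.

Lemma runs_seq c1 c2 k k' p s s' s'' : @runs c1 k p s s' ->
  @runs c2 k' (first_label c2) s' s'' -> @runs (Seq c1 c2) (k + k') (inl p) s s''.
Proof.
elim=> {k p s s'} [p s e|p p' k s s' e _ IH] h.
  by apply: (@runs_next (Seq c1 c2) (inl p) _ _ _ _ _ (runs_seqr _ h)); rewrite /= e.
by apply: (@runs_next (Seq c1 c2) (inl p) _ _ _ _ _ (IH h)); rewrite /= e.
Qed.

Lemma runs_ifl t c1 c2 k p s s' : @runs c1 k p s s' ->
  @runs (If t c1 c2) k (Some (inl p)) s s'.
Proof.
elim=> {k p s s'} [p s e|p p' k s s' e _ IH].
  by apply: (@runs_exit (If t c1 c2) (Some (inl p))); rewrite /= e.
by apply: (@runs_next (If t c1 c2) (Some (inl p)) _ _ _ _ _ IH); rewrite /= e.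
Qed.

Lemma runs_ifr t c1 c2 k p s s' : @runs c2 k p s s' ->
  @runs (If t c1 c2) k (Some (inr p)) s s'.
Proof.
elim=> {k p s s'} [p s e|p p' k s s' e _ IH].
  by apply: (@runs_exit (If t c1 c2) (Some (inr p))); rewrite /= e.
by apply: (@runs_next (If t c1 c2) (Some (inr p)) _ _ _ _ _ IH); rewrite /= e.
Qed.

Lemma runs_body x y c k k' p s s' s'' : @runs c k p s s' ->
  @runs (For x y c) k' (inl (Some true)) s' s'' -> @runs (For x y c) (k + k') (inr p) s s''.
Proof.
elim=> {k p s s'} [p s e|p p' k s s' e _ IH] h.
  by apply: (@runs_next (For x y c) (inr p) _ _ _ _ _ h); rewrite /= e.
by apply: (@runs_next (For x y c) (inr p) _ _ _ _ _ (IH h)); rewrite /= e.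
Qed.

Fixpoint writes (c : cmd) : seq X :=
  match c with
  | Zero r | Copy r _ | Incr r => [:: r]
  | Out _ => [::]
  | Seq c1 c2 | If _ c1 c2 => writes c1 ++ writes c2
  | For r _ c => r :: writes c
  end.

(** A loop body may change neither the loop counter nor its bound, so the number of rounds is known
    on entry. *)
Fixpoint wf (c : cmd) : bool :=
  match c with
  | Seq c1 c2 | If _ c1 c2 => wf c1 && wf c2
  | For r s c => [&& r != s, r \notin writes c, s \notin writes c & wf c]
  | _ => true
  end.

Definition advance r (s : store) : store := (upd s.1 r (minn L (s.1 r).+1), s.2).

Fixpoint sem (c : cmd) (s : store) : store :=
  match c with
  | Zero r => (upd s.1 r 0, s.2)
  | Copy r x => (upd s.1 r (s.1 x), s.2)
  | Incr r => advance r s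
  | Out b => (s.1, rcons s.2 b)
  | Seq c1 c2 => sem c2 (sem c1 s)
  | If t c1 c2 => if eval w t s.1 then sem c1 s else sem c2 s
  | For r x c =>
    iter (s.1 x) (fun s => advance r (sem c s)) (upd s.1 r 0, s.2)
  end.

(** Each round of a loop adds a test and an increment; the last 2 stands for the initialisation and
    the final test. *)
Fixpoint time (c : cmd) (l : nat) : nat :=
  match c with
  | Seq c1 c2 => time c1 l + time c2 l
  | If _ c1 c2 => (time c1 l + time c2 l).+1
  | For _ _ c => l * (time c l + 2) + 2
  | _ => 1
  end.

Lemma sem_frame c s x : x \notin writes c -> (sem c s).1 x = s.1 x.
Proof.
elim: c s => [r|r y|r|b|c1 IH1 c2 IH2|t c1 IH1 c2 IH2|r y c IH] s //=;
  rewrite ?inE ?mem_cat ?negb_or /upd.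
- by move/negbTE ->.
- by move/negbTE ->.
- by move/negbTE ->.
- by case/andP => h1 h2; rewrite IH2 // IH1.
- by case/andP => h1 h2; case: ifP => _; rewrite (IH1, IH2).
case/andP => xr h; elim: (s.1 y) => [|k IHk] /=; first by rewrite (negbTE xr).
by rewrite /advance /upd /= (negbTE xr) IH.
Qed.

Lemma sem_bounded c s : bounded w s.1 -> bounded w (sem c s).1.
Proof.
have hu e r v : bounded w e -> v <= L -> bounded w (upd e r v).
  by move=> h vL x; rewrite /upd; case: ifP.
elim: c s => [r|r y|r|b|c1 IH1 c2 IH2|t c1 IH1 c2 IH2|r y c IH] s //= h.
- exact: hu.
- exact: hu.
- by apply: hu => //; apply: geq_minl.
- by apply/IH2/IH1.
- by case: ifP => _; [apply: IH1|apply: IH2].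
elim: (s.1 y) => [|k IHk] /=; first exact: hu.
by apply: hu; [apply: IH|apply: geq_minl].
Qed.

Lemma for_counter c r s j : r \notin writes c -> j <= L ->
  (iter j (fun s => advance r (sem c s)) (upd s.1 r 0, s.2)).1 r = j.
Proof.
move=> h; elim: j => [|j IH] jL /=; first by rewrite /upd eqxx.
rewrite /advance /upd /= eqxx sem_frame // IH; last exact: ltnW.
by rewrite (minn_idPr _).
Qed.

Lemma for_frame c r x s j : r != x -> x \notin writes c ->
  (iter j (fun s => advance r (sem c s)) (upd s.1 r 0, s.2)).1 x = s.1 x.
Proof.
move=> rx h; elim: j => [|j IH] /=; first by rewrite /upd eq_sym (negbTE rx).
by rewrite /advance /upd /= eq_sym (negbTE rx) sem_frame.
Qed.

Lemma runs_sem c s : wf c -> bounded w s.1 ->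
  exists2 k, k <= time c L & runs k (first_label c) s (sem c s).
Proof.
elim: c s => [r|r y|r|b|c1 IH1 c2 IH2|t c1 IH1 c2 IH2|r y c IH] [e o] /=.
- by exists 1 => //; apply: (@runs_exit (Zero r)).
- by exists 1 => //; apply: (@runs_exit (Copy r y)).
- by exists 1 => //; apply: (@runs_exit (Incr r)).
- by exists 1 => //; apply: (@runs_exit (Out b)).
- case/andP => w1 w2 eb; have [k1 l1 r1] := IH1 (e, o) w1 eb.
  have [k2 l2 r2] := IH2 _ w2 (@sem_bounded c1 (e, o) eb).
  by exists (k1 + k2); [apply: leq_add|apply: runs_seq r1 r2].
- case/andP => w1 w2 eb; have [k1 l1 r1] := IH1 (e, o) w1 eb.
  have [k2 l2 r2] := IH2 (e, o) w2 eb.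
  case: ifP => ev.
    exists k1.+1; first by lia.
    by apply: (@runs_next (If t c1 c2) None _ _ (e, o) _ _ (runs_ifl _ _ r1)); rewrite /= ev.
  exists k2.+1; first by lia.
  by apply: (@runs_next (If t c1 c2) None _ _ (e, o) _ _ (runs_ifr _ _ r2)); rewrite /= ev.
case/and4P => ry rc yc wc eb.
set S := fun s => advance r (sem c s).
pose st j := iter j S (upd e r 0, o).
have str j : j <= L -> (st j).1 r = j by move=> jL; apply: (for_counter (e, o)).
have sty j : (st j).1 y = e y by apply: (for_frame (e, o)).
have stb j : bounded w (st j).1.
  elim: j => [|j IHj] x; rewrite /st /= /upd; case: ifP => // _; first exact: geq_minl.
  exact: (sem_bounded c IHj).
have ey : e y <= L by exact: eb.
(* Induction on the number [j] of rounds left, from a loop test with counter value [i]. *)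
suff h j i : i + j = e y -> exists2 k, k <= j * (time c L + 2) + 1 &
    @runs (For r y c) k (inl (Some false)) (st i) (st (e y)).
  have [k kl rk] := h (e y) 0 erefl; exists k.+1.
    rewrite -addn1 (leq_trans (leq_add kl (leqnn 1))) // -addnA leq_add2r.
    by rewrite leq_mul2r ey orbT.
  by apply: (@runs_next (For r y c) (inl None) _ _ (e, o) _ _ rk).
have ex t s : exec (ITest t) s = s by case: s.
pose lt : test := fun le _ _ => ~~ le y r.
elim: j i => [|j IHj] i ij.
  exists 1 => //; rewrite -ij addn0 -[X in runs _ _ _ X](ex lt).
  apply: (@runs_exit (For r y c) (inl (Some false)) (st i)).
  by rewrite /= /eval str ?sty -?ij ?addn0 ?leqnn //; lia.
have [k1 l1 r1] := IH (st i) wc (stb i).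
have [|k2 l2 r2] := IHj i.+1; first by lia.
exists (k1 + k2.+1).+1; first by lia.
apply: (@runs_next (For r y c) (inl (Some false)) (inr (first_label c)) _ (st i)).
  rewrite /= /eval str ?sty; last by lia.
  by rewrite -ltnNge (_ : i < e y) //; lia.
rewrite (ex lt); apply: runs_body r1 _.
by apply: (@runs_next (For r y c) (inl (Some true)) _ _ (sem c (st i)) _ _ r2).
Qed.

End Semantics.
Section Compile.
Variable c : cmd.

Definition action (p : label c) (s : summary) : option (label c) * option bool :=
  (next p (verdict (code p) s), if code p is IOut b then Some b else None).

Definition compile : TM :=
  sweeper summary0 (fun p => transition (@code c p)) action start_cell
    (Some (first_label c)).

Local Notation at_rest := (@at_rest cell (label c) summary summary0
  (fun p => transition (@code c p)) action start_cell (Some (first_label c))).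

Lemma size_cells w e : size (cells w e) = (size w).+1.
Proof. by rewrite size_map size_iota. Qed.

(** Every instruction appends at most one bit, so [K] bounds the output length and with it the
    duration of each pass. *)
Lemma runs_reach w k p s s' K : runs w k p s s' -> bounded w s.1 ->
  size s.2 + k <= K ->
  reach (k * (2 * ((size w).+1 + K) + 4)) (at_rest (Some p) (cells w s.1) s.2)
    (at_rest None (cells w s'.1) s'.2).
Proof.
have pass q (t : store) : bounded w t.1 ->
    reach (2 * ((size w).+1 + size t.2) + 4) (at_rest (Some q) (cells w t.1) t.2)
      (at_rest (next q (exec_test w (code q) t.1)) (cells w (exec w (code q) t).1)
        (exec w (code q) t).2).
  move=> tb; have := @pass_reach cell (label c) summary summary0
    (fun p => transition (@code c p)) action start_cell (Some (first_label c))
    q (cells w t.1) t.2.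
  rewrite transduce_cells // /action verdict_at // size_cells /exec /=.
  by case: (code q).
elim=> {k p s s'} [p s e|p p' k s s' e _ IH] sb sK.
  have := pass p s sb; rewrite e mul1n; apply: reach_le; lia.
have := pass p s sb; rewrite e => h.
rewrite mulSn; apply: reach_trans (IH _ _).
- by apply: reach_le h; lia.
- exact: exec_bounded.
- rewrite (leq_trans _ sK) // addnS -addSn leq_add2r /exec /=.
  by case: (code p) => [r|r x|r|b|t] //=; rewrite size_rcons.
Qed.

Lemma compile_halts w : wf c -> 0 < size w -> exists2 t,
  t <= (time c (size w)).+1 * (8 * (size w + time c (size w) + 1)) &
  halts_with compile w t (sem w c (start_env w, [::])).2.
Proof.
move=> wc w0; set s := (start_env w, [::]).
have sb : bounded w s.1 by exact: start_bounded.
have [k kl rk] := runs_sem wc sb.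
have h0 := @init_reach cell (label c) summary summary0
    (fun p => transition (@code c p)) action start_cell (Some (first_label c)) w.
rewrite marks_start // in h0.
have h1 := reach_trans h0 (runs_reach rk sb (leqnn _)).
have [cf [h2 stop out]] := @halt_reach cell (label c) summary summary0
    (fun p => transition (@code c p)) action start_cell (Some (first_label c))
    (cells w (sem w c s).1) (sem w c s).2.
have [t tl e] := reach_trans h1 h2; exists t; last by exists cf.
apply: leq_trans tl _; rewrite size_cells /=.
move: kl w0; set T := time _ _; set L := size w => kl w0; nia.
Qed.

End Compile.
End Language.

(** * The preclustering program *)

Section TimeBound.
Variable X : finType.

(** Each loop raises the exponent by one; sequencing adds constants and exponents. *)
Lemma time_poly (c : cmd X) : exists C d, forall l, time c l <= C * l.+1 ^ d.
Proof.
have pow a b l : a <= b -> l.+1 ^ a <= l.+1 ^ b by move=> ab; apply: leq_pexp2l.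
have pow1 d l : 0 < l.+1 ^ d by rewrite expn_gt0.
have two (c1 c2 : cmd X) : (exists C d, forall l, time c1 l <= C * l.+1 ^ d) ->
    (exists C d, forall l, time c2 l <= C * l.+1 ^ d) ->
    exists C d, forall l, (time c1 l + time c2 l).+1 <= C * l.+1 ^ d.
  move=> [C1 [d1 h1]] [C2 [d2 h2]]; exists (C1 + C2).+1, (d1 + d2) => l.
  have p1 := pow _ _ l (leq_addr d2 d1); have p2 := pow _ _ l (leq_addl d1 d2).
  have := h1 l; have := h2 l; have := pow1 (d1 + d2) l.
  move: p1 p2; set a := _ ^ d1; set b := _ ^ d2; set e := _ ^ (_ + _) => p1 p2 e0 q2 q1.
  have := leq_mul (leqnn C1) p1; have := leq_mul (leqnn C2) p2; lia.
elim: c => [r|r x|r|b|c1 IH1 c2 IH2|t c1 IH1 c2 IH2|r x c [C [d h]]];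
  try by exists 1, 0 => l; rewrite expn0.
- by have [C [d h]] := two _ _ IH1 IH2; exists C, d => l; apply: leq_trans (h l).
- exact: two.
exists (C + 4), d.+1 => l /=; have := h l; have := pow1 d l.
rewrite expnS; set a := _ ^ d => a0 ha.
have : l * (time c l + 2) <= l * (C * a + 2) by rewrite leq_mul2l leq_add2r ha orbT.
nia.
Qed.

End TimeBound.

(** There are enough registers for each routine to have its own arguments, result and scratch space,
    so a call leaves the data of its caller intact and [sem_frame] applies by computation. *)
Definition counter : finType := 'I_50.
Local Notation "# k" := (@Ordinal 50 k isT : counter) (at level 0, k at level 0, only parsing).

Definition END := #0.
Definition N := #1.
Definition K1 := #2.
Definition K2 := #3.
Definition KM := #4.
Definition dummy := #5.

Local Notation "c1 ;; c2" := (Seq c1 c2) (at level 60, right associativity).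

Definition Skip : cmd counter := Copy dummy dummy.
Definition SetFlag f t : cmd counter := If t (Zero f ;; Incr f) (Zero f).
Definition pos f : test counter := fun _ _ zero => ~~ zero f.
Definition ltt x y : test counter := fun le _ _ => ~~ le y x.

Definition Count r x body f : cmd counter :=
  Zero r ;; For x N (body ;; If (pos f) (Incr r) Skip).
Definition Scan x y body : cmd counter := For x N (For y N (If (ltt x y) body Skip)).
Definition Const r k : cmd counter := iter k (fun c => c ;; Incr r) (Zero r).

(** Requiring [N] to equal the loop counter stops the count at the separator, so later true bits are
    ignored. *)
Definition Read_n : cmd counter :=
  Zero N ;;
  For #6 END (If (fun le bit _ => [&& bit #6, le N #6 & le #6 N]) (Incr N) Skip).

Definition qi := #7.
Definition qj := #8.
Definition qf := #9.
(* The position of a pair in the input is found by enumerating all pairs in the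
   order of the encoding. *)
Definition Query : cmd counter :=
  Zero qf ;; Copy #10 N ;; Incr #10 ;;
  Scan #11 #12
    (If (fun le bit _ => bit #10 &&
          (let eq x y := le x y && le y x in
           (eq #11 qi && eq #12 qj) || (eq #11 qj && eq #12 qi)))
        (Zero qf ;; Incr qf) Skip ;;
     Incr #10) ;;
  If (fun le _ _ => le qi qj && le qj qi) (Zero qf ;; Incr qf) Skip.

Definition da := #13.
Definition dr := #14.
Definition Deg : cmd counter :=
  Count dr #15 (Copy qi da ;; Copy qj #15 ;; Query) qf.

Definition ea := #16.
Definition eb := #17.
Definition er := #18.
Definition Dif : cmd counter :=
  Count er #19
    (Copy qi ea ;; Copy qj #19 ;; Query ;; Copy #20 qf ;; Copy qi eb ;; Query ;;
     SetFlag #21 (fun le _ _ => ~~ (le #20 qf && le qf #20))) #21.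

Definition ma := #22.
Definition mb := #23.
Definition mr := #24.
Definition Mul : cmd counter := Zero mr ;; For #25 ma (For #26 mb (Incr mr)).

Definition cu := #27.
Definition cd := #28.
Definition cf := #29.
Definition Center : cmd counter :=
  Copy da cu ;; Deg ;; Copy cd dr ;;
  Count #30 #31
    (Copy qi cu ;; Copy qj #31 ;; Query ;; Copy #32 qf ;;
     Copy ea cu ;; Copy eb #31 ;; Dif ;; Copy ma K2 ;; Copy mb er ;; Mul ;;
     SetFlag #33 (fun le _ zero => ~~ zero #32 && ~~ le mr cd)) #33 ;;
  Copy ma K1 ;; Copy mb #30 ;; Mul ;; SetFlag cf (fun le _ _ => le mr cd).

Definition nv := #34.
Definition nf := #35.
Definition Near : cmd counter :=
  Center ;; Copy ea cu ;; Copy eb nv ;; Dif ;; Copy ma K1 ;; Copy mb er ;; Mul ;;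
  SetFlag nf (fun le _ zero => ~~ zero cf && le mr cd).

Definition lr := #36.
Definition Atom : cmd counter :=
  Copy lr nv ;; For cu N (Near ;; If (pos nf) (Copy lr cu) Skip).

Definition ai := #37.
Definition aj := #38.
Definition af := #39.
Definition ad := #40.
Definition Adm : cmd counter :=
  Copy nv ai ;; Atom ;; Copy #41 lr ;; Copy nv aj ;; Atom ;;
  Copy da ai ;; Deg ;; Copy ad dr ;;
  Count #42 #43
    (Copy qi ai ;; Copy qj #43 ;; Query ;; Copy #44 qf ;;
     Copy qi aj ;; Query ;; Copy #45 qf ;;
     Copy da #43 ;; Deg ;; Copy ma KM ;; Copy mb ad ;; Mul ;;
     SetFlag #46 (fun le _ zero => [&& ~~ zero #44, ~~ zero #45 & le dr mr])) #46 ;;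
  Copy ma KM ;; Copy mb #42 ;; Mul ;;
  SetFlag af (fun le _ _ => ~~ (le #41 lr && le lr #41) && le ad mr).

Definition Print_atoms : cmd counter :=
  For #47 N (Copy nv #47 ;; Atom ;; For #48 lr (Out _ true) ;; Out _ false).
Definition Print_adm : cmd counter :=
  Scan ai aj (Adm ;; If (pos af) (Out _ true) (Out _ false)).

Definition Main : cmd counter :=
  Read_n ;; Const K1 slack ;; Const K2 (2 * slack) ;; Print_atoms ;; Print_adm.
(** The accuracy enters only through the constant loaded into [KM], so the time of [Main] is
    independent of it. *)
Definition Program M : cmd counter := Const KM M ;; Main.

(** * Reasoning rules for commands *)

Section Frame.
Variable w : seq bool.
Local Notation L := (size w).
Local Notation sem := (sem w).
Implicit Types (c : cmd counter) (s : store counter) (x y r f : counter).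

Fixpoint silent c : bool :=
  match c with
  | Out _ => false
  | Seq c1 c2 | If _ c1 c2 => silent c1 && silent c2
  | For _ _ c => silent c
  | _ => true
  end.

Lemma sem_silent c s : silent c -> (sem c s).2 = s.2.
Proof.
elim: c s => [r|r x|r|b|c1 IH1 c2 IH2|t c1 IH1 c2 IH2|r x c IH] s //=.
- by case/andP=> h1 h2; rewrite IH2 // IH1.
- by case/andP=> h1 h2; case: ifP => _; [apply: IH1|apply: IH2].
by move=> h; elim: (s.1 x) => //= k IHk; rewrite IH.
Qed.

Lemma semS c1 c2 s : sem (c1 ;; c2) s = sem c2 (sem c1 s). Proof. by []. Qed.

Lemma ifE t c1 c2 s : sem (If t c1 c2) s = if eval w t s.1 then sem c1 s else sem c2 s.
Proof. by []. Qed.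

Lemma copyE r x s : (sem (Copy r x) s).1 r = s.1 x.
Proof. by rewrite /= /upd eqxx. Qed.

Lemma zeroE r s : (sem (Zero r) s).1 r = 0.
Proof. by rewrite /= /upd eqxx. Qed.

Lemma incrE r s : (sem (Incr r) s).1 r = minn L (s.1 r).+1.
Proof. by rewrite /= /upd eqxx. Qed.

Lemma setflagE f t s : 0 < L -> (sem (SetFlag f t) s).1 f = eval w t s.1.
Proof.
move=> L0; rewrite /SetFlag ifE; case: (eval w t s.1) => /=.
  by rewrite /advance /upd !eqxx; apply/minn_idPr.
by rewrite /upd eqxx.
Qed.

Definition agree (W : seq counter) (s s' : store counter) :=
  forall x, x \notin W -> s'.1 x = s.1 x.

Lemma for_ind (I : nat -> store counter -> Prop) r x c s :
  wf (For r x c) -> s.1 x <= L -> I 0 (upd s.1 r 0, s.2) ->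
  (forall k s', k < s.1 x -> s'.1 r = k -> I k s' -> I k.+1 (advance w r (sem c s'))) ->
  I (s.1 x) (sem (For r x c) s).
Proof.
move=> /and4P[rx rc xc _] xL I0 IS /=.
have rk k : k <= L -> (iter k (fun s => advance w r (sem c s)) (upd s.1 r 0, s.2)).1 r = k.
  exact: for_counter.
suff h k : k <= s.1 x -> I k (iter k (fun s => advance w r (sem c s)) (upd s.1 r 0, s.2)).
  exact: h.
elim: k => [|k IH] kx //; apply: IS => //; first by apply: rk; lia.
by apply: IH; apply: ltnW.
Qed.

Lemma constE r k s : (sem (Const r k) s).1 r = minn L k.
Proof.
elim: k => [|k IH]; first by rewrite /= /upd eqxx minn0.
by rewrite /Const iterS -/(Const r k) semS /= /upd eqxx IH; lia.
Qed.

Lemma advance_neq r x s : x != r -> (advance w r s).1 x = s.1 x.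
Proof. by rewrite /advance /upd /= => /negbTE ->. Qed.

Lemma mulE s : s.1 ma <= L -> s.1 mb <= L -> (sem Mul s).1 mr = minn L (s.1 ma * s.1 mb).
Proof.
move=> aL bL; rewrite /Mul semS; set s1 := sem (Zero mr) s.
have e1 : s1.1 ma = s.1 ma by rewrite sem_frame.
have e2 : s1.1 mb = s.1 mb by rewrite sem_frame.
rewrite -e1 -e2 in aL bL *.
suff : (sem (For #25 ma (For #26 mb (Incr mr))) s1).1 mr = minn L (s1.1 ma * s1.1 mb) /\
  (sem (For #25 ma (For #26 mb (Incr mr))) s1).1 mb = s1.1 mb by case.
apply: (@for_ind (fun k s' => s'.1 mr = minn L (k * s1.1 mb) /\ s'.1 mb = s1.1 mb)) => //.
move=> k s' kx _ [h1 h2].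
suff [h3 h4] : (sem (For #26 mb (Incr mr)) s').1 mr = minn L (k * s1.1 mb + s'.1 mb) /\
    (sem (For #26 mb (Incr mr)) s').1 mb = s1.1 mb.
  by split; rewrite advance_neq ?h4 // h3 h2 mulSn addnC.
apply: (@for_ind (fun j s'' => s''.1 mr = minn L (k * s1.1 mb + j) /\ s''.1 mb = s1.1 mb)) => //.
- by rewrite h2.
- by split; rewrite /upd //= ?h1 ?h2 ?addn0.
move=> j s'' _ _ [h3 h4]; split; rewrite advance_neq //.
by rewrite incrE h3; lia.
Qed.

End Frame.

(** * Correctness of the preclustering program *)

Section Correct.
Variables (n : nat) (plus : rel 'I_n) (M : nat).
Local Notation w := (enc_inst plus).
Local Notation L := (size w).
Local Notation sem := (sem w).
Local Notation adj := (adj plus).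
Local Notation deg := (deg plus).
Local Notation dif := (dif plus).
Implicit Types (c : cmd counter) (s : store counter) (x y r f : counter).

Lemma size_input : L = n + (size (upairs n)).+1.
Proof. by rewrite size_cat size_nseq /= size_map. Qed.

Lemma nL : n < L. Proof. by rewrite size_input; lia. Qed.

(** The parameters available to every routine; the constants are saturated when the input is
    short. *)
Definition ok s := [/\ s.1 N = n, s.1 K1 = minn L slack, s.1 K2 = minn L (2 * slack) &
  s.1 KM = minn L M].

Definition keeps (W : seq counter) := [&& N \notin W, K1 \notin W, K2 \notin W & KM \notin W].

Lemma ok_agree W s s' : keeps W -> agree W s s' -> ok s -> ok s'.
Proof. by case/and4P=> h1 h2 h3 h4 a [e1 e2 e3 e4]; split; rewrite a. Qed.

Lemma ok_sem c s : keeps (writes c) -> ok s -> ok (sem c s).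
Proof. by move=> h; apply: ok_agree (h) _ => x; apply: sem_frame. Qed.

Local Ltac solve_ok :=
  repeat match goal with |- ok (sem ?c ?s) => apply: (@ok_sem c s); first done end;
  try assumption.

(** The body is specified only on states that agree with [s] off the written registers, so arguments
    set before the loop remain available in every round. *)
Lemma countE r x body f s (P : pred 'I_n) :
  ok s -> [&& r != x, r \notin writes body, keeps (r :: x :: writes body) &
    wf (For x N (body ;; If (pos f) (Incr r) Skip))] ->
  (forall (k : 'I_n) s', agree [:: r, x, dummy & writes body] s s' -> ok s' -> s'.1 x = k ->
     (sem body s').1 f = P k) ->
  (sem (Count r x body f) s).1 r = \sum_k (P k : nat).
Proof.
move=> oks /and4P[rx rb kp wfb] h; rewrite /Count semS.
set s1 := sem (Zero r) s; set loop := For _ _ _.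
have [kr kx kb] : [/\ N != r, N != x & N \notin writes body].
  by move: kp; rewrite /keeps !inE !negb_or => /and4P[/and3P[]].
have sn : s1.1 N = n by rewrite sem_frame ?inE //; case: oks.
have s1r : s1.1 r = 0 by rewrite /= /upd eqxx.
have s1y y : y != r -> s1.1 y = s.1 y by rewrite /= /upd => /negbTE ->.
clearbody s1.
have agk s' : agree [:: r, x, dummy & writes body] s s' -> ok s'.
  move=> ag; apply: ok_agree ag oks; move: kp; rewrite /keeps.
  by rewrite !inE !negb_or => /and4P[/and3P[-> -> ->] /and3P[-> -> ->]
     /and3P[-> -> ->] /and3P[-> -> ->]].
suff [_ ->] : agree [:: r, x, dummy & writes body] s (sem loop s1) /\
    (sem loop s1).1 r = \sum_(k < n | k < s1.1 N) (P k : nat).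
  by rewrite sn; apply: eq_bigl => k; rewrite ltn_ord.
apply: (@for_ind w (fun j s' => agree [:: r, x, dummy & writes body] s s' /\
   s'.1 r = \sum_(k < n | k < j) (P k : nat))) => //.
- by rewrite sn ltnW // nL.
- split; last by rewrite big_pred0 // /= /upd (negbTE rx).
  move=> y; rewrite !inE !negb_or => /and4P[yr yx _ _].
  by rewrite /= /upd (negbTE yx) s1y.
move=> j s'; rewrite sn => jn xj [ag er]; pose k := Ordinal jn.
have := h k s' ag (agk _ ag) xj; rewrite semS; set s2 := sem body s' => fk.
have r2 : s2.1 r = s'.1 r by rewrite sem_frame.
have sumS : \sum_(i < n | i < j.+1) (P i : nat) = P k + \sum_(i < n | i < j) (P i : nat).
  rewrite (bigD1 k) //=; congr (_ + _); apply: eq_bigl => i.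
  by rewrite ltnS ltn_neqAle -val_eqE andbC.
(* The count is at most [n < L], so the increment does not saturate. *)
have le : s2.1 r < L.
  rewrite r2 er; apply: leq_ltn_trans nL; apply: leq_trans (_ : \sum_(i < n) 1 <= _).
    by rewrite big_mkcond; apply: leq_sum => i _; case: ifP => // _; apply: leq_b1.
  by rewrite sum1_card card_ord.
have step : agree [:: r, x, dummy & writes body] s (sem (If (pos f) (Incr r) Skip) s2) /\
    (sem (If (pos f) (Incr r) Skip) s2).1 r = P k + s'.1 r.
  have ag2 y : y \notin [:: r, x, dummy & writes body] -> s2.1 y = s.1 y.
    move=> yW; rewrite -ag // sem_frame //; move: yW.
    by rewrite !inE !negb_or => /and4P[].
  rewrite ifE /eval /pos fk; case: (P k) => /=; split => //.
  - move=> y yW; rewrite /advance /upd /= -ag2 //; move: yW.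
    by rewrite !inE negb_or => /andP[/negbTE ->].
  - by rewrite /advance /upd eqxx /= r2 (minn_idPr _) // -r2.
  - move=> y yW; rewrite /upd /= -ag2 //; case: eqP => // e.
    by move: yW; rewrite e !inE eqxx !orbT.
  - rewrite /upd; case: eqP => [e|//]; by rewrite -e.
case: step => ag3 er3; split.
  move=> y yW; rewrite /advance /upd /=; move: (yW); rewrite !inE !negb_or.
  by case/and4P => _ /negbTE -> _ _; apply: ag3.
by rewrite /advance /upd /= (negbTE rx) er3 er sumS.
Qed.

Definition row (i : 'I_n) : seq ('I_n * 'I_n) :=
  [seq (i, j) | j : 'I_n <- [seq j : 'I_n <- enum 'I_n | i < j]].

Lemma upairsE : upairs n = flatten [seq row i | i <- enum 'I_n].
Proof. by []. Qed.

Lemma enum_split (k : 'I_n) :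
  enum 'I_n = take k (enum 'I_n) ++ k :: drop k.+1 (enum 'I_n).
Proof.
by rewrite -[LHS](cat_take_drop k) (drop_nth k) ?size_enum_ord // nth_ord_enum.
Qed.

Lemma take_enum (k : 'I_n) : take k.+1 (enum 'I_n) = rcons (take k (enum 'I_n)) k.
Proof. by rewrite (take_nth k) ?size_enum_ord // nth_ord_enum. Qed.

(** The invariant is indexed by the prefix of [upairs n] visited so far. It must survive writes to
    the loop counters and to [dummy], which [Skip] overwrites. *)
Lemma scan_ind (I : seq ('I_n * 'I_n) -> store counter -> Prop) x y body s :
  wf (Scan x y body) -> x != y -> N \notin writes (Scan x y body) -> x \notin writes body ->
  s.1 N = n ->
  (forall l s' z v, z \in [:: x; y; dummy] -> I l s' -> I l (upd s'.1 z v, s'.2)) ->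
  (forall l s' (i j : 'I_n) rest, i < j -> upairs n = l ++ (i, j) :: rest ->
     s'.1 x = i -> s'.1 y = j -> s'.1 N = n -> I l s' -> I (rcons l (i, j)) (sem body s')) ->
  I [::] s -> I (upairs n) (sem (Scan x y body) s).
Proof.
move=> wfs xy NW xb sn Iz Ib I0.
have [wfi xN [NI xI] [Ny yx]] : [/\ wf (For y N (If (ltt x y) body Skip)), x != N,
    N \notin writes (If (ltt x y) body Skip) /\ x \notin writes (If (ltt x y) body Skip) &
    N != y /\ y != x].
  move: wfs; rewrite -/(For y N (If (ltt x y) body Skip)) => /and4P[xN].
  by rewrite !inE !negb_or => /andP[xy' xI] /andP[Ny NI] d; split=> //;
    split=> //; rewrite eq_sym.
have Nx : N != x by rewrite eq_sym.
have nL' := ltnW nL.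
have eT : take (s.1 N) (enum 'I_n) = enum 'I_n by rewrite take_oversize // size_enum_ord sn.
rewrite upairsE -eT.
suff [] : (sem (Scan x y body) s).1 N = n /\
  I (flatten [seq row i | i <- take (s.1 N) (enum 'I_n)]) (sem (Scan x y body) s) by [].
apply: (@for_ind w (fun a s' => s'.1 N = n /\ I (flatten [seq row i | i <- take a (enum 'I_n)]) s')
  x N) => //.
- by rewrite sn.
- split; first by rewrite /= /upd (negbTE Nx).
  by rewrite take0; apply: Iz; rewrite // inE eqxx.
move=> a s1; rewrite sn => an s1x [s1N Is1]; pose i := Ordinal an.
set pre := flatten _ in Is1.
(* The prefix reached in row [i] after the columns below [b]. *)
pose J b := pre ++ [seq (i, j) | j <- [seq j : 'I_n <- take b (enum 'I_n) | i < j]].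
suff [e1 e2] : (sem (For y N (If (ltt x y) body Skip)) s1).1 N = n /\
    I (J n) (sem (For y N (If (ltt x y) body Skip)) s1).
  split; first by rewrite advance_neq.
  rewrite -[a]/(nat_of_ord i) take_enum map_rcons flatten_rcons -/pre.
  rewrite /J take_oversize ?size_enum_ord // in e2.
  by apply: Iz => //; rewrite inE eqxx.
suff [e1 _ e2] : [/\ (sem (For y N (If (ltt x y) body Skip)) s1).1 N = n,
   (sem (For y N (If (ltt x y) body Skip)) s1).1 x = a &
   I (J (s1.1 N)) (sem (For y N (If (ltt x y) body Skip)) s1)] by rewrite s1N in e2.
apply: (@for_ind w (fun b s' => [/\ s'.1 N = n, s'.1 x = a & I (J b) s']) y N) => //.
- by rewrite s1N.
- split; rewrite /= /upd ?(negbTE Ny) ?(negbTE xy) //.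
  by rewrite /J take0 cats0; apply: Iz; rewrite // !inE eqxx orbT.
move=> b s2; rewrite s1N => bn s2y [s2N s2x Is2]; pose j := Ordinal bn.
suff [e1 e2 e3] : [/\ (sem (If (ltt x y) body Skip) s2).1 N = n,
   (sem (If (ltt x y) body Skip) s2).1 x = a &
   I (J b.+1) (sem (If (ltt x y) body Skip) s2)].
  split; rewrite ?advance_neq //.
  by apply: Iz => //; rewrite !inE eqxx orbT.
split; rewrite ?sem_frame //.
have -> : J b.+1 = if i < j then rcons (J b) (i, j) else J b.
  rewrite /J -[b]/(nat_of_ord j) take_enum filter_rcons.
  by case: ifP => _ //; rewrite map_rcons rcons_cat.
rewrite ifE /eval /ltt s2x s2y -ltnNge -[a < b]/(i < j).
case: ifP => ij; last by apply: Iz => //; rewrite !inE eqxx !orbT.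
rewrite /J; apply: (Ib _ _ _ _ ([seq (i, k) | k <- [seq k : 'I_n <- drop b.+1 (enum 'I_n) | i < k]]
   ++ flatten [seq row k | k <- drop a.+1 (enum 'I_n)])) => //.
rewrite upairsE {1}(enum_split i) map_cat flatten_cat /= -/pre -catA; congr (_ ++ _).
rewrite /row {1}(enum_split j) filter_cat /= ij map_cat /= -catA.
by [].
Qed.

Lemma mem_upairs (p : 'I_n * 'I_n) : (p \in upairs n) = (p.1 < p.2).
Proof.
apply/allpairsPdep/idP => [[i [j [_]]]|].
  by rewrite mem_filter => /andP[ij _] ->.
case: p => i j ij; exists i, j; split; rewrite ?mem_enum //; by rewrite mem_filter mem_enum andbT.
Qed.

Lemma input_pair l (i j : 'I_n) rest : upairs n = l ++ (i, j) :: rest ->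
  nth false w (n.+1 + size l) = plus i j /\ n.+1 + size l < L.
Proof.
move=> e; rewrite size_input e size_cat /=; split; last by lia.
rewrite /enc_inst nth_cat size_nseq ltnNge (_ : n <= _) /=; last by lia.
rewrite (_ : n.+1 + size l - n = (size l).+1) /=; last by lia.
rewrite (nth_map (i, j)) e; last by rewrite size_cat /=; lia.
by rewrite nth_cat ltnn subnn.
Qed.

Lemma queryE s (i j : 'I_n) : ok s -> s.1 qi = i -> s.1 qj = j ->
  (sem Query s).1 qf = adj i j.
Proof.
move=> [sN _ _ _] si sj.
pose P (p : 'I_n * 'I_n) := plus p.1 p.2 &&
  ((p.1 == i) && (p.2 == j) || (p.1 == j) && (p.2 == i)).
have adjE : (i == j) || has P (upairs n) = adj i j.
  rewrite /adj; case: (i == j) => //=; apply/hasP/orP.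
    case=> -[a b]; rewrite mem_upairs /P /= => ab /andP[pab].
    by case/orP => /andP[/eqP <- /eqP <-]; [left|right]; rewrite ab pab.
  case=> /andP[lt pl]; [exists (i, j)|exists (j, i)]; rewrite ?mem_upairs //.
    by rewrite /P /= pl !eqxx.
  by rewrite /P /= pl !eqxx orbT.
rewrite /Query !semS; set s1 := sem (Incr _) _.
have s1N : s1.1 N = n by rewrite !sem_frame.
have s1i : s1.1 qi = i by rewrite !sem_frame.
have s1j : s1.1 qj = j by rewrite !sem_frame.
have s1f : s1.1 qf = 0 by rewrite sem_frame // sem_frame // zeroE.
(* The pairs start at cell [n + 1], after [n] ones and the separator. *)
have s1p : s1.1 #10 = n.+1.
  by rewrite incrE copyE sem_frame // sN; apply/minn_idPr/nL.
clearbody s1; set sc := Scan _ _ _.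
pose I l (s' : store counter) := [/\ s'.1 qi = i, s'.1 qj = j, s'.1 #10 = n.+1 + size l &
  s'.1 qf = has P l].
have [s2i s2j _ s2f] : I (upairs n) (sem sc s1).
  apply: scan_ind => //.
  - move=> l s' z v; rewrite !inE => /or3P[] /eqP ->; rewrite /I /upd //=.
  - move=> l s' a b rest ab e s'a s'b _ [h1 h2 h3 h4].
    have [bit ltL] := input_pair e; rewrite semS.
    set t := fun _ _ _ => _; set s2 := sem (If t _ _) s'.
    split; [by rewrite sem_frame // sem_frame|by rewrite sem_frame // sem_frame| |].
      by rewrite incrE sem_frame // h3 size_rcons addnS; apply/minn_idPr.
    rewrite sem_frame //.
    have tE : eval w t s'.1 = P (a, b).
      rewrite /eval /t s'a s'b h1 h2 h3 bit /P /= -!eqn_leq.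
      by [].
    rewrite has_rcons -tE /s2 ifE; case: (eval w t s'.1) => /=.
      rewrite /advance /upd eqxx /=; apply/minn_idPr; exact: leq_ltn_trans nL.
    by rewrite /upd.
  - by split; rewrite // addn0.
rewrite -adjE; set s2 := sem sc s1 in s2i s2j s2f *.
rewrite ifE {1}/eval s2i s2j -eqn_leq -[nat_of_ord i == _]/(i == j).
case: (i == j) => /=; last by rewrite /upd.
by rewrite /advance /upd eqxx /=; apply/minn_idPr; apply: leq_ltn_trans nL.
Qed.

Lemma degE s (u : 'I_n) : ok s -> s.1 da = u -> (sem Deg s).1 dr = deg u.
Proof.
move=> oks su; apply: countE => // k s' ag ok' xk; rewrite 2!semS.
apply: queryE; first by solve_ok.
- by rewrite sem_frame // copyE ag.
- by rewrite copyE sem_frame.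
Qed.

Lemma difE s (u v : 'I_n) : ok s -> s.1 ea = u -> s.1 eb = v -> (sem Dif s).1 er = dif u v.
Proof.
move=> oks su sv; apply: (@countE _ _ _ _ _ (fun k => adj u k != adj v k)) => // k s' ag ok' xk.
rewrite 6!semS setflagE; last exact: leq_ltn_trans nL.
rewrite /eval -eqn_leq.
set s1 := sem (Copy qj _) _; set s2 := sem (Copy qi eb) _.
have q1 : (sem Query s1).1 qf = adj u k.
  apply: queryE; first by rewrite /s1; solve_ok.
    by rewrite sem_frame // copyE ag.
  by rewrite copyE sem_frame.
have q2 : (sem Query s2).1 qf = adj v k.
  apply: queryE; first by rewrite /s2 /s1; solve_ok.
    by rewrite copyE 4?sem_frame // ag.
  by rewrite 3?sem_frame // copyE sem_frame.
rewrite q2 sem_frame // sem_frame // copyE q1.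
by case: (adj u k) (adj v k) => [] [].
Qed.

(* Products computed with counters that saturate at [l] still compare correctly
   with values below [l]. *)
Lemma satE (l b x d : nat) : d < l -> (minn l (minn l b * x) <= d) = (b * x <= d).
Proof.
move=> dl; case: (leqP l b) => lb; last by lia.
by case: x => [|x]; rewrite ?muln0 ?mulnS; lia.
Qed.

Lemma L_gt0 : 0 < L. Proof. exact: leq_ltn_trans nL. Qed.

Lemma centerE s (u : 'I_n) : ok s -> s.1 cu = u ->
  (sem Center s).1 cf = center plus u /\ (sem Center s).1 cd = deg u.
Proof.
move=> oks su; rewrite /Center 7!semS; set s1 := sem (Copy cd dr) _.
have ok1 : ok s1 by rewrite /s1; solve_ok.
have s1d : s1.1 cd = deg u.
  by rewrite copyE; apply: degE; [solve_ok|rewrite copyE].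
have s1u : s1.1 cu = u by rewrite 3?sem_frame.
clearbody s1; set cnt := Count _ _ _ _.
have s2c : (sem cnt s1).1 #30 = \sum_k (adj u k && (deg u < 2 * slack * dif u k) : nat).
  apply: (@countE _ _ _ _ _ (fun k => adj u k && (deg u < 2 * slack * dif u k)))
    => // k s' ag ok' xk.
  rewrite 10!semS; set t1 := sem (Copy #32 _) _; set t2 := sem (Copy mb _) _.
  have t1f : t1.1 #32 = adj u k.
    rewrite copyE; apply: queryE; first by solve_ok.
      by rewrite sem_frame // copyE ag.
    by rewrite copyE sem_frame.
  have okt1 : ok t1 by rewrite /t1; solve_ok.
  have t1u : t1.1 cu = u by rewrite 4?sem_frame // ag.
  have t1k : t1.1 #31 = k by rewrite 4?sem_frame.
  have t1d : t1.1 cd = deg u by rewrite 4?sem_frame // ag.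
  clearbody t1.
  have t2b : t2.1 mb = dif u k.
    rewrite copyE sem_frame //; apply: difE; first by solve_ok.
      by rewrite sem_frame // copyE.
    by rewrite copyE sem_frame.
  have t2a : t2.1 ma = minn L (2 * slack).
    rewrite sem_frame // copyE; have [_ _ <- _] := okt1.
    by rewrite 3?sem_frame.
  have t2f : t2.1 #32 = adj u k by rewrite 5?sem_frame.
  have t2d : t2.1 cd = deg u by rewrite 5?sem_frame.
  clearbody t2.
  rewrite setflagE ?L_gt0 // /eval mulE ?t2a ?t2b ?geq_minl //; last first.
    exact: leq_trans (dif_le _ _ _) (ltnW nL).
  rewrite ![(sem Mul t2).1 _]sem_frame // t2f t2d satE; last first.
    exact: leq_ltn_trans (deg_le _ _) nL.
  by rewrite -ltnNge; case: (adj u k).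
set s2 := sem cnt s1 in s2c *.
have ok2 : ok s2 by rewrite /s2; solve_ok.
have s2d : s2.1 cd = deg u by rewrite sem_frame.
clearbody s2; split; last by rewrite 4?sem_frame.
set s3 := sem (Copy mb #30) _.
have s3b : s3.1 mb = s2.1 #30 by rewrite copyE sem_frame.
have s3a : s3.1 ma = minn L slack.
  by rewrite sem_frame // copyE; case: ok2.
have s3d : s3.1 cd = deg u by rewrite 2?sem_frame.
have cL : s2.1 #30 <= L.
  rewrite s2c; apply: leq_trans (ltnW nL); rewrite -[X in _ <= X]card_ord -sum1_card.
  by apply: leq_sum => x _; apply: leq_b1.
rewrite setflagE ?L_gt0 // /eval mulE ?s3a ?s3b ?geq_minl //.
rewrite sem_frame // s3d satE; last exact: leq_ltn_trans (deg_le _ _) nL.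
by rewrite s2c.
Qed.

Lemma nearE s (u v : 'I_n) : ok s -> s.1 cu = u -> s.1 nv = v ->
  (sem Near s).1 nf = near plus u v.
Proof.
move=> oks su sv; rewrite /Near 7!semS; set s1 := sem Center s.
have [s1f s1d] := centerE oks su; rewrite -/s1 in s1f s1d.
have ok1 : ok s1 by rewrite /s1; solve_ok.
have s1u : s1.1 cu = u by rewrite sem_frame.
have s1v : s1.1 nv = v by rewrite sem_frame.
clearbody s1; set s2 := sem (Copy mb _) _.
have s2b : s2.1 mb = dif u v.
  rewrite copyE sem_frame //; apply: difE; first by solve_ok.
    by rewrite sem_frame // copyE.
  by rewrite copyE sem_frame.
have s2a : s2.1 ma = minn L slack.
  rewrite sem_frame // copyE; have [_ <- _ _] := ok1.
  by rewrite 3?sem_frame.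
have s2f : s2.1 cf = center plus u by rewrite 5?sem_frame.
have s2d : s2.1 cd = deg u by rewrite 5?sem_frame.
clearbody s2.
rewrite setflagE ?L_gt0 // /eval mulE ?s2a ?s2b ?geq_minl //; last first.
  exact: leq_trans (dif_le _ _ _) (ltnW nL).
rewrite ![(sem Mul s2).1 _]sem_frame // s2f s2d satE; last first.
  exact: leq_ltn_trans (deg_le _ _) nL.
by rewrite /near; case: (center plus u).
Qed.

(** The loop visits the vertices in the order of [enum], so overwriting [lr] reproduces the fold
    defining [atom]. *)
Lemma atomE s (v : 'I_n) : ok s -> s.1 nv = v -> (sem Atom s).1 lr = atom plus v.
Proof.
move=> oks sv; rewrite /Atom semS; set s1 := sem (Copy lr nv) s.
have s1l : s1.1 lr = v by rewrite copyE.
have s1v : s1.1 nv = v by rewrite sem_frame.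
have ok1 : ok s1 by rewrite /s1; solve_ok.
clearbody s1; set loop := For _ _ _; have [s1N _ _ _] := ok1.
pose F l u := if near plus u v then u else l : 'I_n.
suff [_ _] : [/\ ok (sem loop s1), (sem loop s1).1 nv = v &
    (sem loop s1).1 lr = foldl F v (take (s1.1 N) (enum 'I_n))].
  by rewrite s1N take_oversize ?size_enum_ord.
apply: (@for_ind w (fun k s' => [/\ ok s', s'.1 nv = v &
  s'.1 lr = foldl F v (take k (enum 'I_n))])) => //.
- by rewrite s1N ltnW // nL.
- by split; rewrite ?take0.
move=> k s'; rewrite s1N => kn s'u [ok' s'v s'l]; pose u := Ordinal kn.
have okn : ok (sem Near s') by solve_ok.
rewrite semS -[k]/(nat_of_ord u) take_enum foldl_rcons {1}/F.
have fE := nearE (u := u) ok' s'u s'v; set s2 := sem Near s' in okn fE *.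
have s2u : s2.1 cu = u by rewrite sem_frame.
have s2v : s2.1 nv = v by rewrite sem_frame.
have s2l : s2.1 lr = foldl F v (take k (enum 'I_n)) by rewrite sem_frame.
clearbody s2; set s3 := sem (If _ _ _) s2.
have ok3 : ok s3 by rewrite /s3; solve_ok.
split.
- by apply: (@ok_agree [:: cu] s3) => // x; rewrite inE => h; apply: advance_neq.
- by rewrite advance_neq // sem_frame.
have evE : eval w (pos nf) s2.1 = near plus u v.
  by rewrite /eval /pos fE; case: (near plus u v).
rewrite advance_neq // /s3 ifE evE; case: (near plus u v); last by rewrite sem_frame.
by rewrite copyE.
Qed.

(** Companion of [satE] for lower bounds; [d = l] is allowed because a saturated product equals
    [l]. *)
Lemma le_satE (l b x d : nat) : d <= l -> (d <= minn l (minn l b * x)) = (d <= b * x).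
Proof.
move=> dl; case: (leqP l b) => lb; last by lia.
by case: x => [|x]; rewrite ?muln0 ?mulnS; lia.
Qed.

Lemma sum_le_L (P : pred 'I_n) : \sum_k (P k : nat) <= L.
Proof.
apply: leq_trans (ltnW nL); rewrite -[X in _ <= X]card_ord -sum1_card.
by apply: leq_sum => k _; apply: leq_b1.
Qed.

Lemma admE s (i j : 'I_n) : ok s -> s.1 ai = i -> s.1 aj = j ->
  (sem Adm s).1 af = admissible plus M i j.
Proof.
move=> oks si sj; rewrite /Adm 12!semS; set s1 := sem (Copy #41 lr) _.
have s1a : s1.1 #41 = atom plus i.
  by rewrite copyE; apply: atomE; [solve_ok|rewrite copyE].
have ok1 : ok s1 by rewrite /s1; solve_ok.
have s1i : s1.1 ai = i by rewrite 3?sem_frame.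
have s1j : s1.1 aj = j by rewrite 3?sem_frame.
clearbody s1; set s2 := sem Atom _.
have s2a : s2.1 lr = atom plus j.
  by apply: atomE; [solve_ok|rewrite copyE].
have ok2 : ok s2 by rewrite /s2; solve_ok.
have s2i : s2.1 ai = i by rewrite 2?sem_frame.
have s2j : s2.1 aj = j by rewrite 2?sem_frame.
have s2b : s2.1 #41 = atom plus i by rewrite 2?sem_frame.
clearbody s2; set s3 := sem (Copy ad dr) _.
have s3d : s3.1 ad = deg i.
  by rewrite copyE; apply: degE; [solve_ok|rewrite copyE].
have ok3 : ok s3 by rewrite /s3; solve_ok.
have s3i : s3.1 ai = i by rewrite 3?sem_frame.
have s3j : s3.1 aj = j by rewrite 3?sem_frame.
have s3a : s3.1 lr = atom plus j by rewrite 3?sem_frame.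
have s3b : s3.1 #41 = atom plus i by rewrite 3?sem_frame.
clearbody s3; set s4 := sem (Count _ _ _ _) _.
have s4c : s4.1 #42 = witnesses plus M i j.
  apply: (@countE _ _ _ _ _ (fun k => [&& adj i k, adj j k & deg k <= M * deg i]))
    => // k s' ag ok' xk.
  rewrite 12!semS; set t1 := sem (Copy #44 _) _.
  have t1f : t1.1 #44 = adj i k.
    rewrite copyE; apply: queryE; first by solve_ok.
      by rewrite sem_frame // copyE ag.
    by rewrite copyE sem_frame.
  have okt1 : ok t1 by rewrite /t1; solve_ok.
  have t1j : t1.1 aj = j by rewrite 4?sem_frame // ag.
  have t1q : t1.1 qj = k by rewrite 2?sem_frame // copyE sem_frame.
  have t1k : t1.1 #43 = k by rewrite 4?sem_frame.
  have t1d : t1.1 ad = deg i by rewrite 4?sem_frame // ag.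
  clearbody t1; set t2 := sem (Copy #45 _) _.
  have t2f : t2.1 #45 = adj j k.
    rewrite copyE; apply: queryE; first by solve_ok.
      by rewrite copyE.
    by rewrite sem_frame.
  have okt2 : ok t2 by rewrite /t2; solve_ok.
  have t2i : t2.1 #44 = adj i k by rewrite 3?sem_frame.
  have t2k : t2.1 #43 = k by rewrite 3?sem_frame.
  have t2d : t2.1 ad = deg i by rewrite 3?sem_frame.
  clearbody t2; set t3 := sem (Copy mb _) _.
  have t3r : t3.1 dr = deg k.
    rewrite 2?sem_frame //; apply: degE; first by solve_ok.
    by rewrite copyE.
  have t3a : t3.1 ma = minn L M.
    rewrite sem_frame // copyE; have [_ _ _ <-] := okt2.
    by rewrite 2?sem_frame.
  have t3b : t3.1 mb = deg i by rewrite copyE 3?sem_frame.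
  have t3i : t3.1 #44 = adj i k by rewrite 4?sem_frame.
  have t3j : t3.1 #45 = adj j k by rewrite 4?sem_frame.
  clearbody t3.
  have dL (v : 'I_n) : deg v <= L by apply: leq_trans (deg_le _ _) (ltnW nL).
  rewrite setflagE ?L_gt0 // /eval mulE ?t3a ?t3b ?geq_minl //.
  rewrite ![(sem Mul t3).1 _]sem_frame // t3r t3i t3j le_satE //.
  by case: (adj i k); case: (adj j k).
have ok4 : ok s4 by rewrite /s4; solve_ok.
have s4a : s4.1 lr = atom plus j by rewrite sem_frame.
have s4b : s4.1 #41 = atom plus i by rewrite sem_frame.
have s4d : s4.1 ad = deg i by rewrite sem_frame.
clearbody s4; set s5 := sem (Copy mb _) _.
have s5a : s5.1 ma = minn L M by rewrite sem_frame // copyE; case: ok4.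
have s5b : s5.1 mb = witnesses plus M i j by rewrite copyE sem_frame.
have s5l : s5.1 lr = atom plus j by rewrite 2?sem_frame.
have s5m : s5.1 #41 = atom plus i by rewrite 2?sem_frame.
have s5d : s5.1 ad = deg i by rewrite 2?sem_frame.
clearbody s5.
rewrite setflagE ?L_gt0 // /eval mulE ?s5a ?s5b ?geq_minl //; last exact: sum_le_L.
rewrite ![(sem Mul s5).1 _]sem_frame // s5l s5m s5d le_satE; last first.
  exact: leq_trans (deg_le _ _) (ltnW nL).
by rewrite -eqn_leq.
Qed.

Lemma print_atomsE s : ok s -> ok (sem Print_atoms s) /\ (sem Print_atoms s).2 =
  s.2 ++ flatten [seq rcons (nseq (atom plus i) true) false | i <- enum 'I_n].
Proof.
move=> oks; have [sN _ _ _] := oks.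
set G := fun i : 'I_n => rcons (nseq (atom plus i) true) false.
split; first by solve_ok.
have eT : take (s.1 N) (enum 'I_n) = enum 'I_n by rewrite take_oversize // size_enum_ord sN.
rewrite -eT.
suff [] : ok (sem Print_atoms s) /\ (sem Print_atoms s).2 =
  s.2 ++ flatten [seq G i | i <- take (s.1 N) (enum 'I_n)] by [].
apply: (@for_ind w (fun k s' => ok s' /\
  s'.2 = s.2 ++ flatten [seq G i | i <- take k (enum 'I_n)])) => //.
- by rewrite sN ltnW // nL.
- by split; rewrite // take0 cats0.
move=> k s'; rewrite sN => kn s'k [ok' s'o]; pose i := Ordinal kn.
set t := sem _ s'; have okt : ok t by rewrite /t; solve_ok.
split; first by apply: (@ok_agree [:: #47] t) => // x; rewrite inE => h; apply: advance_neq.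
rewrite -[k]/(nat_of_ord i) take_enum map_rcons flatten_rcons catA -s'o.
rewrite -[LHS]/(t.2) /t 3!semS; set t1 := sem Atom _.
have t1a : t1.1 lr = atom plus i by apply: atomE; [solve_ok|rewrite copyE s'k].
have t1o : t1.2 = s'.2 by rewrite 2?sem_silent.
clearbody t1; rewrite -[LHS]/(rcons _ false) /G -rcons_cat; congr rcons.
rewrite -t1a -t1o; apply: (@for_ind w (fun j u => u.2 = t1.2 ++ nseq j true)) => //.
- by rewrite t1a; apply/ltnW/(ltn_trans (ltn_ord _) nL).
- by rewrite cats0.
move=> j u _ _ uo; rewrite -[LHS]/(rcons u.2 true) uo -[j.+1]addn1 nseqD catA cats1.
by [].
Qed.

Lemma print_admE s : ok s -> (sem Print_adm s).2 =
  s.2 ++ [seq admissible plus M p.1 p.2 | p <- upairs n].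
Proof.
move=> oks; have [sN _ _ _] := oks.
suff [] : ok (sem Print_adm s) /\ (sem Print_adm s).2 =
  s.2 ++ [seq admissible plus M p.1 p.2 | p <- upairs n] by [].
apply: (@scan_ind (fun l s' => ok s' /\ s'.2 = s.2 ++ [seq admissible plus M p.1 p.2 | p <- l]))
  => //.
- move=> l s' z v zW [ok' s'o]; split=> //.
  apply: (@ok_agree [:: ai; aj; dummy] s') => // x xW.
  by rewrite /= /upd; case: eqP => // e; rewrite e zW in xW.
- move=> l s' i j rest ij e s'i s'j _ [ok' s'o].
  split; first by solve_ok.
  rewrite semS map_rcons -rcons_cat -s'o; have := admE ok' s'i s'j.
  have : (sem Adm s').2 = s'.2 by rewrite sem_silent.
  set t := sem Adm s' => to ta; rewrite ifE /eval /pos ta -to.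
  by case: (admissible plus M i j).
- by split; rewrite // cats0.
Qed.

Lemma read_nE s : s.1 END = L -> (sem Read_n s).1 N = n.
Proof.
move=> sE; rewrite /Read_n semS; set s1 := sem (Zero N) s.
have s1E : s1.1 END = L by rewrite sem_frame.
have s1N : s1.1 N = 0 by rewrite zeroE.
clearbody s1; set loop := For _ _ _.
suff : (sem loop s1).1 N = minn (s1.1 END) n by rewrite s1E (minn_idPr (ltnW nL)).
apply: (@for_ind w (fun k s' => s'.1 N = minn k n)) => //.
- by rewrite s1E.
- by rewrite min0n.
move=> k s' kL s'k s'N; rewrite advance_neq // ifE.
have -> : eval w (fun le bit _ => [&& bit #6, le N #6 & le #6 N]) s'.1 = (k < n).
  rewrite /eval -eqn_leq s'k s'N /enc_inst nth_cat size_nseq.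
  case: ltngtP => kn; rewrite ?nth_nseq ?kn ?subnn ?eqxx //=.
  by rewrite ltn_eqF ?andbF.
case: ifP => kn; last by rewrite sem_frame // s'N; lia.
by rewrite incrE s'N; have := nL; lia.
Qed.

Lemma const_writes r k : writes (Const r k) =i [:: r].
Proof.
elim: k => // k IH x; rewrite /Const iterS -/(Const r k) /= mem_cat IH !inE.
by rewrite orbb.
Qed.

Lemma const_silent r k : silent (Const r k).
Proof. by elim: k => // k IH; rewrite /Const iterS -/(Const r k) /= IH. Qed.

Lemma const_wf r k : wf (Const r k).
Proof. by elim: k => // k IH; rewrite /Const iterS -/(Const r k) /= IH. Qed.

Lemma const_time r k l : time (Const r k) l = k.+1.
Proof. by elim: k => // k IH; rewrite /Const iterS -/(Const r k) /= IH addn1. Qed.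

Lemma programE : (sem (Program M) (start_env END w, [::])).2 =
  enc_out (fun i => atom plus i : nat) (admissible plus M).
Proof.
rewrite /Program /Main 5!semS; set s1 := sem (Const KM M) _.
have fr r k x s : x != r -> (sem (Const r k) s).1 x = s.1 x.
  by move=> xr; rewrite sem_frame // const_writes inE.
have s1K : s1.1 KM = minn L M by rewrite constE.
have s1E : s1.1 END = L by rewrite fr.
have s1o : s1.2 = [::] by rewrite sem_silent ?const_silent.
clearbody s1; set s4 := sem (Const K2 _) _.
have ok4 : ok s4.
  split; [by rewrite 2?fr // read_nE|by rewrite fr // constE|by rewrite constE|].
  by rewrite 2?fr // sem_frame.
have s4o : s4.2 = [::] by rewrite sem_silent ?const_silent // sem_silent ?const_silent //
  sem_silent.
clearbody s4; have [ok5 o5] := print_atomsE ok4.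
by rewrite print_admE // o5 s4o.
Qed.

Lemma wf_program : wf (Program M).
Proof. by rewrite /Program /= const_wf; vm_compute. Qed.

End Correct.

(** * Polynomial running time *)

Lemma size_upairs n : size (upairs n) <= n * n.
Proof.
rewrite upairsE size_flatten /shape -map_comp sumnE big_map big_enum /=.
apply: leq_trans (_ : \sum_(i < n) n <= _); last by rewrite sum_nat_const card_ord.
apply: leq_sum => i _; rewrite size_map size_filter.
by apply: leq_trans (count_size _ _) _; rewrite size_enum_ord.
Qed.

Lemma time_program M l : time (Program M) l = M.+1 + time Main l.
Proof. by rewrite -(const_time KM M l). Qed.

(** The constants [A] and [D] are uniform in [m]: the time of [Main] is polynomial in the input
    length, and [m] adds only the instructions that load [KM]. *)
Lemma program_halts : exists A D, forall m, exists TM0 : TM,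
  forall n (plus : rel 'I_n), exists2 t, t <= A * (n + m.+1) ^ D &
    halts_with TM0 (enc_inst plus) t
      (enc_out (fun i => atom plus i : nat) (admissible plus (4 * m.+1))).
Proof.
have [C [d h]] := time_poly Main; pose a := C * 4 ^ d.
exists (8 * (6 + a) * (9 + a)), (4 * d + 3) => m.
exists (compile END (Program (4 * m.+1))) => n plus.
have [t tle ht] := compile_halts END (wf_program (4 * m.+1)) (L_gt0 plus).
exists t; last by rewrite -programE.
apply: leq_trans tle _; rewrite time_program.
have := h (size (enc_inst plus)); have := size_upairs n; rewrite size_input.
set T := time Main _; set L := n + _; set z := n + m.+1 => hu hT.
have z0 : 0 < z by rewrite /z addnS.
(* The input length is quadratic in [n], whence the exponent [2 * d] for the time of [Main]. *)
have hL : L.+1 <= 4 * z ^ 2.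
  by rewrite /L /z; move: hu; rewrite mulnn; nia.
have zp k : 0 < z ^ k by rewrite expn_gt0 z0.
have hT' : T <= a * z ^ (2 * d).
  apply: leq_trans hT _; rewrite /a -mulnA leq_mul2l; apply/orP; right.
  rewrite expnM -expnMn; case: (posnP d) => [->|d0]; first by rewrite !expn0.
  by rewrite leq_exp2r.
have mz : m.+1 <= z by apply: leq_addl.
set Z := z ^ (2 * d) in hT' *; have Z0 : 0 < Z by apply: zp.
have p1 : z <= z * Z by rewrite leq_pmulr.
have p2 : a * Z <= a * (z * Z) by rewrite leq_mul2l leq_pmull ?orbT.
have p3 : z ^ 2 <= z ^ 2 * Z by rewrite leq_pmulr.
have p4 : z * Z <= z ^ 2 * Z by rewrite leq_mul2r -{1}[z]expn1 leq_pexp2l ?orbT.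
have p5 : a * (z * Z) <= a * (z ^ 2 * Z) by rewrite leq_mul2l p4 orbT.
have h1 : (4 * m.+1).+1 + T < (6 + a) * (z * Z) by rewrite mulnDl; lia.
have h2 : L + ((4 * m.+1).+1 + T) + 1 <= (9 + a) * (z ^ 2 * Z) by rewrite mulnDl; lia.
apply: leq_trans (leq_mul h1 (leq_mul (leqnn 8) h2)) _.
rewrite /Z -expnS -expnD; set p := z ^ _; set q := z ^ (2 + _).
rewrite (_ : z ^ (4 * d + 3) = p * q); last by rewrite -expnD; congr (_ ^ _); lia.
by apply: eq_leq; ring.
Qed.

(** * Choice of the parameters in terms of [eps] *)

Local Open Scope ring_scope.

Theorem theorem6 (R : realType) :
  exists c : R, 0 < c /\
  exists eps0 : R, 0 < eps0 /\
  exists (C : R) (d : nat),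
  forall eps : R, 0 < eps < eps0 ->
  exists M : TM,
  forall (n : nat) (plus : rel 'I_n),
  exists (t : nat) (out : seq bool),
    halts_with M (enc_inst plus) t out /\
    t%:R <= C * (n%:R + eps^-1) ^+ d /\
    exists (lab : 'I_n -> nat) (adm : rel 'I_n),
      out = enc_out lab adm /\
      preclustered lab adm /\
      (exists cl : {ffun 'I_n -> 'I_n},
         good lab adm cl /\
         (cc_cost plus cl)%:R <= (1 + eps) * (cc_opt plus)%:R) /\
      (num_adm adm)%:R <= c / eps ^+ 2 * (cc_opt plus)%:R.
Proof.
have [A [D h]] := program_halts.
have [K hK] : exists K, forall n (plus : rel 'I_n) cl M,
  (num_adm (admissible plus M) <= (4 * M ^ 2 + K) * cc_cost plus cl)%N.
  by eexists => n plus cl M; apply: num_adm_le.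
(* [576 = 4 * 4 ^ 2 * 3 ^ 2] comes from the term [4 * M ^ 2] with [M = 4 * m.+1] and
   [m.+1 <= 3 / eps]. *)
exists (576 + K%:R); split; first by have := ler0n R K; lra.
(* The factor [3 ^ D] absorbs [n + m + 1 <= 3 * (n + 1 / eps)], which relies on [eps < 1]. *)
exists 1; split=> //; exists (A * 3 ^ D)%:R, D => eps /andP[eps0 eps1].
have x1 : 1 < eps^-1 by rewrite invf_gt1.
have xeps : eps^-1 * eps = 1 by rewrite mulVf // gt_eqF.
(* The penalty parameter is [m.+1], so the cost exceeds the optimum by a factor of at most
   [1 + 1 / m], which is below [1 + eps]. *)
pose m := (Num.truncn eps^-1).+1.
have /andP[m_le m_gt] : m.-1%:R <= eps^-1 < m%:R by apply: truncn_itv; lra.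
have {m_le} m_le : m.+1%:R <= 3 * eps^-1.
  by move: m_le; rewrite /m /= -[X in X%:R <= 3 * _]addn2 natrD; lra.
have [TM0 hTM] := h m; exists TM0 => n plus.
have [t tle ht] := hTM n plus.
exists t, (enc_out (fun i => atom plus i : nat) (admissible plus (4 * m.+1))).
split=> //; split.
  have e : (n + m.+1)%:R <= 3 * (n%:R + eps^-1) :> R.
    by rewrite natrD; have := ler0n R n; lra.
  apply: (@le_trans _ _ (A%:R * (n + m.+1)%:R ^+ D)).
    by rewrite -natrX -natrM ler_nat.
  rewrite natrM -mulrA ler_wpM2l // natrX -exprMn.
  by rewrite lerXn2r ?nnegrE ?ler0n // mulr_ge0 // addr_ge0 //; lra.
exists (fun i => atom plus i : nat), (admissible plus (4 * m.+1)); split=> //; split.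
  by move=> i j _; rewrite /admissible => /andP[].
have [cl gcl ccl] := exists_good plus (isT : (1 < m.+1)%N).
rewrite /cc_opt; set o := [arg min_(_ < _) _]%O; set opt := cc_cost plus o.
have opt0 := ler0n R opt.
split.
  exists cl; split=> //; have := ccl o; rewrite -(ler_nat R) subn1 /= !natrM -/opt => hc.
  have m0 : 0 < m%:R :> R by rewrite ltr0n.
  rewrite -(ler_pM2l m0); apply: le_trans hc _.
  rewrite mulrA ler_wpM2r // -natr1 mulrDr mulr1 lerD2l.
  apply: (@le_trans _ _ (eps^-1 * eps)); first by rewrite xeps.
  by apply: ler_wpM2r; apply: ltW.
have := hK n plus o (4 * m.+1)%N; rewrite -/opt -(ler_nat R) natrM => hn.
apply: le_trans hn _; rewrite ler_wpM2r // -exprVn.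
have -> : (4 * (4 * m.+1) ^ 2 + K)%:R = 64 * m.+1%:R ^+ 2 + K%:R :> R.
  by rewrite natrD !(natrM, natrX); ring.
rewrite [X in _ <= X]mulrDl; apply: lerD.
  have : m.+1%:R ^+ 2 <= (3 * eps^-1) ^+ 2 :> R.
    by rewrite lerXn2r ?nnegrE ?ler0n // mulr_ge0 //; lra.
  by rewrite exprMn => hm; lra.
by rewrite -[X in X <= _]mulr1 ler_wpM2l // expr_ge1 ?ltW //; lra.
Qed.
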